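(* Let $$A = \{ (x,y) \in \mathbf{Bad}^2 : \exists\, c(x,y) > 0 \text{ such that for all } n \geq 1:\ q_n(x)\,\|q_n(x)x\|\,\|q_n(x)y\| \geq c(x,y) \text{ and } q_n(y)\,\|q_n(y)x\|\,\|q_n(y)y\| \geq c(x,y)\} \subset \mathbb{R}^2.$$ Then $$\frac{3}{2} \leq \dim_H A \leq 2.$$
   Context: For real $t$, $\|t\|$ denotes the distance from $t$ to the nearest integer. $\mathbf{Bad}$ is the set of badly approximable numbers: $\mathbf{Bad} = \{ \alpha \in \mathbb{R} : \exists\, c(\alpha) > 0 \text{ such that } \|q\alpha\| > c(\alpha) q^{-1} \text{ for all integers } q \geq 1 \}$ (all such numbers are irrational). For an irrational real $\alpha$ with regular continued fraction expansion $\alpha = [a_0; a_1, a_2, \ldots]$ ($a_0 \in \mathbb{Z}$, $a_i$ positive integers for $i\ge 1$), $p_n(\alpha)/q_n(\alpha) = [a_0; a_1, \ldots, a_n]$ denotes its $n$-th convergent in lowest terms with $q_n(\alpha) \geq 1$, so $q_n(\alpha)$ is the denominator of the $n$-th convergent. $\dim_H$ denotes Hausdorff dimension. *)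

(* Defs.v *)
From mathcomp Require Import all_boot all_order all_algebra.
From mathcomp Require Import all_classical all_reals all_analysis.

Set Implicit Arguments.
Unset Strict Implicit.
Unset Printing Implicit Defensive.

Import Order.TTheory GRing.Theory Num.Theory.

Local Open Scope classical_set_scope.
Local Open Scope ring_scope.

Definition dist_int (R : realType) (t : R) : R :=
  inf [set `|t - m%:~R| | m in [set: int]].

Definition Bad (R : realType) : set R :=
  [set alpha : R | exists2 c : R, 0 < c &
    forall q : nat, (1 <= q)%N -> c * q%:R^-1 < dist_int (q%:R * alpha)].

(* The n-th complete quotient: alpha_0 = alpha and
   alpha_(n+1) = 1 / (alpha_n - floor alpha_n).  For irrational alpha the
   fractional parts never vanish; for rational alpha the values past the end of
   the expansion are junk. *)
Definition complete_quotient (R : realType) (alpha : R) (n : nat) : R :=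
  iter n (fun t : R => (t - (Num.floor t)%:~R)^-1) alpha.

Definition partial_quotient (R : realType) (alpha : R) (n : nat) : int :=
  Num.floor (complete_quotient alpha n).

(* [a_0; a_1, ..., a_k] = a_0 + 1 / [a_1; a_2, ..., a_k].  The empty sequence
   gets the value 0, and 0^-1 = 0, so that [a_0] has the value a_0. *)
Fixpoint cf_value (a : seq int) : rat :=
  if a is a0 :: a' then a0%:~R + (cf_value a')^-1 else 0.

Definition convergent (R : realType) (alpha : R) (n : nat) : rat :=
  cf_value (mkseq (partial_quotient alpha) n.+1).

(* denq is the positive denominator in lowest terms. *)
Definition cf_denom (R : realType) (alpha : R) (n : nat) : R :=
  (denq (convergent alpha n))%:~R.

Section HausdorffDimension.
Variables (R : realType) (T : Type) (dist : T -> T -> R).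
Local Open Scope ereal_scope.

(* The empty set has diameter 0. *)
Definition diameter (U : set T) : \bar R :=
  maxe 0 (ereal_sup [set (dist u v)%:E | u in U & v in U]).

(* |U|^s, where |U|^0 = 1 for nonempty U and the empty set contributes 0, also
   when s = 0. *)
Definition hausdorff_gauge (s : R) (U : set T) : \bar R :=
  if pselect (U = set0) then 0 else diameter U `^ s.

Definition delta_cover (delta : R) (E : set T) (U : (set T)^nat) : Prop :=
  E `<=` \bigcup_i U i /\ forall i, diameter (U i) <= delta%:E.

(* H^s_delta and H^s = sup over delta > 0 of H^s_delta.  Finite covers are
   included, by padding with empty sets. *)
Definition hausdorff_premeasure (s delta : R) (E : set T) : \bar R :=
  ereal_inf [set \sum_(i <oo) hausdorff_gauge s (U i)
            | U in delta_cover delta E].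

Definition hausdorff_measure (s : R) (E : set T) : \bar R :=
  ereal_sup [set hausdorff_premeasure s delta E
            | delta in [set delta : R | (0 < delta)%R]].

Definition hausdorff_dim (E : set T) : \bar R :=
  ereal_inf [set s%:E | s in [set s : R | (0 <= s)%R /\
                                          hausdorff_measure s E = 0]].

End HausdorffDimension.

(* The library's norm on R * R is the sup norm, hence an explicit Euclidean
   distance. *)
Definition euclidean_dist (R : realType) (u v : R * R) : R :=
  Num.sqrt ((u.1 - v.1) ^+ 2 + (u.2 - v.2) ^+ 2).

Definition cf_littlewood_set (R : realType) : set (R * R) :=
  [set xy : R * R | [/\ Bad xy.1, Bad xy.2 &
    exists2 c : R, 0 < c & forall n : nat, (1 <= n)%N ->
      let x := xy.1 in let y := xy.2 in
      c <= cf_denom x n * dist_int (cf_denom x n * x)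
                        * dist_int (cf_denom x n * y) /\
      c <= cf_denom y n * dist_int (cf_denom y n * x)
                        * dist_int (cf_denom y n * y)]].

(* Main.v *)
Require Import Defs.
From mathcomp Require Import all_boot all_order all_algebra.
From mathcomp Require Import all_classical all_reals all_analysis.
From mathcomp Require Import measurable_realfun ring lra zify.

(** Why the dimension is at least 3/2.  For badly approximable x and y, the
    product q ||qx|| ||qy|| at a denominator q of x stays away from 0 as soon as
    ||qy|| does.  So it is enough to find many pairs in Bad^2 for which
    ||q_n(x) y|| and ||q_n(y) x|| are bounded below.  The abscissa x is chosen
    first, in a Cantor set of dimension close to 1 on which the constant of
    bad approximability is uniform; then y is chosen, for this x, in a Cantor set
    of dimension close to 1/2.

    The abscissae ([bad_parametrization]).  In an interval of a suitable length
    at most one fraction p/q, with q^2 in a given range [r^k, r^(k+1)), is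
    dangerous ([close_fractions]), and its neighbourhood spoils at most one of
    the r/2 separated subintervals of relative length 1/r.  The dimension tends
    to 1 with r.

    The ordinates ([fibre_parametrization]).  The partial quotients of y are
    taken in [M, 2M).  If the denominators q' and q of two successive
    convergents of y are known, then the next denominator is a q + q', and the
    numbers (a q + q') x, a = M, M + 1, ..., are an orbit of the rotation by q x.
    If ||qx|| >= e, then of three successive points of such an orbit one is at
    distance at least e from the integers ([one_of_three]): the bound
    ||q_n(y) x|| >= e is inherited with the same e, at the cost of keeping one
    digit out of three.  The denominators of x grow geometrically, so that only
    O(log M) of them matter at the scale of a given generation
    ([near_denom_block]), and the condition ||q_n(x) y|| >= e at each of them
    removes at most one child ([good_children]).  Some M / 6 children remain,
    of relative length about M^-2; this is where the 1/2 comes from.  Bounded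
    partial quotients make y badly approximable ([branch_bad]).

    Adding the dimensions.  Both Cantor sets are coded by digits in [0, 1), by
    maps whose inverses are Hoelder ([cantor_tree]).  Given a cover of the set of
    pairs (phi t, psi_t u) by sets of diameters d_i, each fibre over t is covered,
    whence a lower bound for the sum of d_i^b over the i that are met above t;
    integrating it over t yields a lower bound for the sum of the d_i^(a + b)
    ([hausdorff_measure_param_neq0]).  Only intervals of parameters t are
    integrated, so the dependence of psi_t on t may be arbitrary.

    The upper bound is the covering of the plane by grids with 4^n cells of
    side 2 v^n, where v > 1/2 and 4 v^s < 1 ([hausdorff_premeasure_plane]). *)

Set Implicit Arguments.
Unset Strict Implicit.
Unset Printing Implicit Defensive.
Import Order.TTheory GRing.Theory Num.Theory.

(** * Continued fractions and the distance to the nearest integer *)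

Section Convergents.
Local Open Scope classical_set_scope.
Local Open Scope ring_scope.
Variable R : realType.
Implicit Types (t c x y : R) (s : seq int).

Lemma dist_int_lbound t : has_lbound [set `|t - m%:~R| | m in [set: int]].
Proof. by exists 0 => _ [m _ <-]. Qed.

Lemma dist_int_le t (m : int) : dist_int t <= `|t - m%:~R|.
Proof. by apply: ge_inf; [exact: dist_int_lbound | exists m]. Qed.

Lemma dist_int_ge t c : (forall m : int, c <= `|t - m%:~R|) -> c <= dist_int t.
Proof.
move=> h; apply: lb_le_inf; first by exists `|t - 0%:~R|; exists 0.
by move=> _ [m _ <-].
Qed.

Lemma dist_int_lt t c : dist_int t < c -> exists m : int, `|t - m%:~R| < c.
Proof.
move=> h; have [|_ [m _ <-] hm] := inf_lt _ h; last by exists m.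
by exists `|t - 0%:~R|; exists 0.
Qed.

(** A state ((p', q'), (p, q)) holds two successive convergents p'/q' and
    p/q; the initial one ((0, 1), (1, 0)) precedes the first partial quotient. *)
Definition conv_step (st : (int * int) * (int * int)) (a : int) :=
  (st.2, (a * st.2.1 + st.1.1, a * st.2.2 + st.1.2)).

Definition conv_state s := foldl conv_step ((0, 1), (1, 0)) s.

(** Numerator and denominator of [a_0; a_1, ...] computed from the left, in
    the order in which [cf_value] consumes the sequence.  The empty continued
    fraction is 1/0, which is also the value 0 of [cf_value [::]]. *)
Fixpoint continuant s : int * int :=
  if s is a :: s' then
    (a * (continuant s').1 + (continuant s').2, (continuant s').1)
  else (1, 0).

Lemma continuant_pos s : all (> 0) s ->
  0 < (continuant s).1 /\ 0 <= (continuant s).2.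
Proof.
elim: s => //= a s IH /andP[a0 /IH[h1 h2]]; split; last exact: ltW.
by rewrite ltr_wpDr // mulr_gt0.
Qed.

Lemma cf_value_pos s : all (> 0) s ->
  cf_value s = (continuant s).1%:~R / (continuant s).2%:~R.
Proof.
elim: s => [|a s IH] /=; first by rewrite invr0 mulr0.
move=> /andP[a0 hs]; have [h1 h2] := continuant_pos hs.
rewrite IH // invf_div rmorphD rmorphM /=.
by field; rewrite intr_eq0 gt_eqF.
Qed.

Lemma cf_value_cons a s : all (> 0) s ->
  cf_value (a :: s) = (continuant (a :: s)).1%:~R / (continuant (a :: s)).2%:~R.
Proof.
move=> hs; have [h1 h2] := continuant_pos hs.
rewrite /= cf_value_pos // invf_div rmorphD rmorphM /=.
by field; rewrite intr_eq0 gt_eqF.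
Qed.

(** A state acts on the value of the remaining partial quotients as a 2 x 2
    matrix; this reconciles the recurrence that appends a partial quotient with
    [continuant], which prepends one. *)
Lemma foldl_conv_step st s :
  (foldl conv_step st s).2 =
  (st.2.1 * (continuant s).1 + st.1.1 * (continuant s).2,
   st.2.2 * (continuant s).1 + st.1.2 * (continuant s).2).
Proof.
elim: s st => [|a s IH] [[p' q'] [p q]] /=; first by congr pair; ring.
by rewrite IH /=; congr pair; ring.
Qed.

Lemma conv_state_continuant s : (conv_state s).2 = continuant s.
Proof.
rewrite /conv_state foldl_conv_step /= mul1r mul0r addr0 mul0r mul1r add0r.
by case: (continuant s).
Qed.

Definition conv_det (st : (int * int) * (int * int)) : int :=
  st.2.1 * st.1.2 - st.1.1 * st.2.2.

Lemma conv_det_step st a : conv_det (conv_step st a) = - conv_det st.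
Proof. by rewrite /conv_det /=; ring. Qed.

Lemma conv_det_state s : conv_det (conv_state s) = 1 \/ conv_det (conv_state s) = -1.
Proof.
elim/last_ind: s => [|s a IH]; first by left.
rewrite /conv_state foldl_rcons conv_det_step.
by case: IH => ->; [right | left; rewrite opprK].
Qed.

Definition cf_state (alpha : R) n := conv_state (mkseq (partial_quotient alpha) n).

Lemma cf_stateS alpha n : cf_state alpha n.+1 =
  conv_step (cf_state alpha n) (partial_quotient alpha n).
Proof. by rewrite /cf_state mkseqS /conv_state foldl_rcons. Qed.

(** The fraction produced by the recurrence is in lowest terms because its
    determinant with the previous one is 1 or -1. *)
Lemma cf_denomE alpha n : (forall i, (0 < i)%N -> 0 < partial_quotient alpha i) ->
  cf_denom alpha n = (cf_state alpha n.+1).2.2%:~R /\ 0 < (cf_state alpha n.+1).2.2.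
Proof.
move=> h; rewrite /cf_denom /convergent /cf_state.
have -> : mkseq (partial_quotient alpha) n.+1 =
  partial_quotient alpha 0 :: [seq partial_quotient alpha i | i <- iota 1 n].
  by [].
set s := [seq _ | _ <- _].
have hs : all (> 0) s.
  by apply/allP => z /mapP[i]; rewrite mem_iota => /andP[i0 _] ->; exact: h.
rewrite cf_value_cons // !conv_state_continuant.
have [h1 _] := continuant_pos hs.
split => //; rewrite coprimeq_den.
  by rewrite gt_eqF // gtr0_norm.
have := conv_det_state (partial_quotient alpha 0 :: s).
rewrite /conv_det conv_state_continuant.
set st := conv_state _ => hd; apply/coprimezP.
case: hd => hd.
  by exists (st.1.2, - st.1.1); rewrite -hd /=; ring.
by exists (- st.1.2, st.1.1); transitivity (- (-1 : int)); [rewrite -hd /=; ring | by []].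
Qed.
End Convergents.

Section BadConvergents.
Local Open Scope classical_set_scope.
Local Open Scope ring_scope.
Variable R : realType.
Implicit Types (t c x y : R) (s : seq int).

#[local] Arguments complete_quotient : simpl never.
#[local] Arguments partial_quotient : simpl never.

Lemma complete_quotientS x n : complete_quotient x n.+1 =
  (complete_quotient x n - (partial_quotient x n)%:~R)^-1.
Proof. by []. Qed.

(** The invariants of the expansion of a badly approximable number.  They
    are proved together: the complete quotient is not an integer because
    otherwise the next convergent would be equal to x, and it is this fact that
    makes the following complete quotient greater than 1.  The last equation is
    x = (b p + p') / (b q + q') without denominators. *)
Lemma bad_cf_state x n : Bad x ->
  let: ((p', q'), (p, q)) := cf_state x n in
  let a := partial_quotient x n in
  let b := complete_quotient x n in
  [/\ 0 <= q', 0 <= q, 0 < a * q + q', a%:~R < b & ((0 < n)%N -> 1 < b) /\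
      q'%:~R * x - p'%:~R = - b * (q%:~R * x - p%:~R)].
Proof.
move=> [c c0 hc].
have key (p q : int) : 0 < q -> q%:~R * x - p%:~R = 0 -> False.
  case: q => // q q0 /eqP; rewrite subr_eq0 => /eqP h.
  have /hc : (0 < q)%N by [].
  rewrite -pmulrn in h; rewrite h.
  move=> /lt_le_trans /(_ (dist_int_le _ p)); rewrite subrr normr0.
  by rewrite ltNge mulr_ge0 // ?invr_ge0 // ltW.
have fl (z : R) : (Num.floor z)%:~R <= z < (Num.floor z)%:~R + 1.
  by have := floor_itv z; rewrite rmorphD.
elim: n => [|n].
  rewrite /cf_state /= /partial_quotient; have -> : complete_quotient x 0 = x by [].
  have /andP[f1 f2] := fl x.
  split => //; last by split => //; rewrite mul0r mul1r; ring.
    by rewrite mulr0 add0r.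
  rewrite lt_neqAle f1 andbT; apply/eqP => h.
  apply: (key (Num.floor x) 1) => //.
  by rewrite mul1r h subrr.
rewrite cf_stateS; case: (cf_state x n) => [[p' q'] [p q]] /=.
rewrite complete_quotientS.
set a := partial_quotient x n; set b := complete_quotient x n.
move=> [q'0 q0 q1 ab [_ rel]].
have /andP[_] := fl b; rewrite -/(partial_quotient x n) -/a => ba.
have b1 : 1 < (b - a%:~R)^-1.
  by rewrite invf_gt1 ?subr_gt0 // ltrBlDl.
have relS : q%:~R * x - p%:~R = - (b - a%:~R)^-1 *
    ((a * q + q')%:~R * x - (a * p + p')%:~R).
  rewrite !rmorphD !rmorphM /=.
  have -> : (a%:~R * q%:~R + q'%:~R) * x - (a%:~R * p%:~R + p'%:~R) =
    a%:~R * (q%:~R * x - p%:~R) + (q'%:~R * x - p'%:~R) :> R by ring.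
  by rewrite rel; field; rewrite subr_eq0 gt_eqF.
have a1 : 1 <= partial_quotient x n.+1.
  rewrite /partial_quotient floor_ge_int complete_quotientS -/a -/b.
  exact: ltW.
have q2 : 0 < partial_quotient x n.+1 * (a * q + q') + q by nia.
split => //; first exact: ltW.
have /andP[] := fl (b - a%:~R)^-1.
rewrite le_eqVlt => /orP[/eqP h _|//]; exfalso.
apply: (key (partial_quotient x n.+1 * (a * p + p') + p) _ q2).
rewrite rmorphD rmorphM /= [X in _ - X]rmorphD [X in _ - (X + _)]rmorphM /=.
have -> : (partial_quotient x n.+1)%:~R = (b - a%:~R)^-1 by rewrite -[RHS]h.
by move: relS; lra.
Qed.

Lemma bad_cf_denom x n : Bad x -> exists q : nat,
  [/\ (0 < q)%N, cf_denom x n = q%:R, (cf_state x n.+1).2.2 = q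
    & exists p : int, `|q%:R * x - p%:~R| <= q%:R^-1].
Proof.
move=> hx.
have apos i : (0 < i)%N -> 0 < partial_quotient x i.
  move=> i0; have := bad_cf_state i hx.
  case: (cf_state x i) => [[p' q'] [p q]] [_ _ _ _ [/(_ i0) b _]].
  by rewrite floor_gt0 ltW.
have [-> q0] := cf_denomE n apos.
have := bad_cf_state n.+1 hx.
have := conv_det_state (mkseq (partial_quotient x) n.+1).
rewrite -/(cf_state x n.+1) /conv_det.
case: (cf_state x n.+1) q0 => [[p' q'] [p q]] /= q0 det.
move=> [q'0 _ _ ab [/(_ isT) b1 rel]].
case: q q0 det rel => // q q0 det rel.
exists q; split => //.
exists p.
set b := complete_quotient x n.+1 in b1 rel *.
have q0' : 0 < q%:R :> R by rewrite ltr0n.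
have q'R : 0 <= q'%:~R :> R by rewrite ler0z.
have E : q%:~R * (q'%:~R * x - p'%:~R) - q'%:~R * (q%:~R * x - p%:~R) =
   (p * q' - p' * q)%:~R :> R.
  by rewrite rmorphB !rmorphM /=; ring.
have N : `|(p * q' - p' * q)%:~R : R| = 1.
  by case: det => ->; rewrite ?normrN ?normr1.
rewrite -E rel -pmulrn in N.
have : (b * q%:R + q'%:~R) * `|q%:R * x - p%:~R| = 1.
  rewrite -[RHS]N -[b * _ + _]ger0_norm; last first.
    by apply: addr_ge0 => //; apply: mulr_ge0 => //; rewrite ltW // (lt_trans ltr01).
  by rewrite -normrM -normrN; congr `|_|; ring.
move=> N1; rewrite -[leRHS]mul1r ler_pdivlMr // mulrC -[leRHS]N1.
apply: ler_wpM2r => //.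
rewrite -[leLHS]addr0 lerD //.
by rewrite ler_peMl // ltW.
Qed.
End BadConvergents.

(** * Growth estimates and selection *)

Section Auxiliary.
Local Open Scope classical_set_scope.
Local Open Scope ring_scope.
Variable R : realType.

Lemma powRX (x a : R) n : 0 <= x -> (x ^+ n) `^ a = (x `^ a) ^+ n.
Proof.
move=> x0; elim: n => [|n IH]; first by rewrite !expr0 powR1.
by rewrite !exprS powRM // ?exprn_ge0 // IH.
Qed.

Lemma ler_powR_base (a x y : R) : 0 <= a -> 0 <= x -> x <= y -> x `^ a <= y `^ a.
Proof.
move=> a0 x0 xy; apply: ge0_ler_powR => //; rewrite nnegrE //.
exact: le_trans xy.
Qed.

(** Every obstacle of the list s kills at most one of G candidates, so at
    least N of them survive and can be enumerated injectively. *)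
Lemma select_survivors (T : eqType) (G N : nat) (s : seq T) (kill : T -> nat -> Prop) :
  (forall q, q \in s -> forall g h, (g < G)%N -> (h < G)%N ->
     kill q g -> kill q h -> g = h) ->
  (N + size s <= G)%N ->
  exists e : nat -> nat, forall d, (d < N)%N -> [/\ (e d < G)%N,
    (forall q, q \in s -> ~ kill q (e d)) &
    (forall d', (d' < N)%N -> e d = e d' -> d = d')].
Proof.
move=> uk sz.
have /choice[h hh] : forall q, exists h, q \in s ->
    forall g, (g < G)%N -> kill q g -> g = h.
  move=> q; have [[g [gG kg]]|no] := pselect (exists g, (g < G)%N /\ kill q g).
    by exists g => qs g' g'G kg'; exact: (uk q qs).
  by exists 0%N => qs g gG kg; exfalso; apply: no; exists g.
pose good := [seq g <- iota 0 G | g \notin map h s].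
have ug : uniq good by rewrite filter_uniq // iota_uniq.
have sg : (N <= size good)%N.
  have := count_predC [pred g | g \in map h s] (iota 0 G).
  rewrite size_iota /good size_filter => e.
  suff : (count [pred g | g \in map h s] (iota 0 G) <= size s)%N.
    have -> : count (fun g => g \notin map h s) (iota 0 G) =
      count (predC [pred g | g \in map h s]) (iota 0 G) by apply: eq_count.
    by move: e sz; lia.
  rewrite -size_filter -[leqRHS](size_map h); apply: uniq_leq_size.
    by rewrite filter_uniq // iota_uniq.
  by move=> x; rewrite mem_filter => /andP[].
exists (nth 0%N good) => d dN.
have ds : (d < size good)%N by exact: leq_trans sg.
have : nth 0%N good d \in good by exact: mem_nth.
rewrite mem_filter mem_iota add0n => /andP[nd dG]; split => //.
  move=> q qs kq; move: nd; rewrite (hh q qs _ dG kq) => /negP; apply.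
  exact: map_f.
move=> d' d'N /eqP; rewrite nth_uniq // ?(leq_trans d'N) //.
by move/eqP.
Qed.

(** Used to see that a tree with m children of relative size 1/(C m), or
    1/(C m)^2, has dimension at least e, or e/2, for every e < 1 once m is large. *)
Lemma powR_le_linear (e C : R) : 0 < e < 1 -> 0 < C ->
  exists m0 : nat, forall m : nat, (m0 <= m)%N -> (C * m%:R) `^ e <= m%:R.
Proof.
move=> /andP[e0 e1] C0.
pose B := (C `^ e) `^ (1 - e)^-1.
exists (Num.bound B).+1 => m hm.
have m0 : 0 < m%:R :> R by rewrite ltr0n (leq_trans _ hm).
have Bm : B <= m%:R.
  apply: ltW; apply: lt_le_trans (archi_boundP (powR_ge0 _ _)) _.
  by rewrite ler_nat ltnW.
rewrite powRM ?(ltW C0) ?(ltW m0) //.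
have E : m%:R = m%:R `^ (1 - e) * m%:R `^ e :> R.
  by rewrite -powRD ?subrK ?powRr1 ?(ltW m0) // (gt_eqF m0) implybT.
rewrite [leRHS]E ler_wpM2r ?powR_ge0 //.
have -> : C `^ e = B `^ (1 - e).
  by rewrite /B -powRrM mulVf ?powRr1 ?powR_ge0 // subr_eq0 gt_eqF.
by apply: ler_powR_base => //; [rewrite subr_ge0 ltW | exact: powR_ge0].
Qed.

Lemma powR_inv_mul (x a : R) : 0 < x -> x `^ a * (x^-1) `^ a = 1.
Proof.
by move=> x0; rewrite -powRM ?invr_ge0 ?(ltW x0) // divff ?powR1 // gt_eqF.
Qed.

(** Distinct fractions with denominators q and q' are at least 1/(q q')
    apart. *)
Lemma close_fractions (p p' : int) (q q' : nat) (B : R) :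
  (0 < q)%N -> (0 < q')%N -> q%:R ^+ 2 < B -> q'%:R ^+ 2 < B ->
  `|p%:~R / q%:R - p'%:~R / q'%:R| <= B^-1 ->
  p%:~R / q%:R = p'%:~R / q'%:R :> R.
Proof.
move=> q0 q'0 qB q'B.
have qR : 0 < q%:R :> R by rewrite ltr0n.
have q'R : 0 < q'%:R :> R by rewrite ltr0n.
have B0 : 0 < B by apply: le_lt_trans qB; exact: sqr_ge0.
have -> : p%:~R / q%:R - p'%:~R / q'%:R =
    (p * Posz q' - p' * Posz q)%:~R / (q%:R * q'%:R) :> R.
  rewrite rmorphB !rmorphM /= -!pmulrn; field.
  by rewrite !gt_eqF.
have [/eqP z|nz] := eqVneq (p * Posz q' - p' * Posz q) 0.
  move=> _; rewrite subr_eq0 in z; apply/eqP.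
  rewrite eqr_div ?(gt_eqF qR) ?(gt_eqF q'R) // !pmulrn -!rmorphM /=.
  by rewrite (eqP z).
move=> h; exfalso; move: h; apply/negP; rewrite -ltNge.
have qq : q%:R * q'%:R < B by nra.
rewrite normrM [X in _ * X]ger0_norm; last by rewrite invr_ge0 mulr_ge0 // ltW.
apply: (@lt_le_trans _ _ (q%:R * q'%:R)^-1).
  by rewrite ltf_pV2 ?posrE // mulr_gt0.
apply: ler_peMl; first by rewrite invr_ge0 mulr_ge0 // ltW.
by rewrite norm_intr_ge1 ?intr_eq0 // rpred_int.
Qed.
Lemma bernoulli_ineq (h : R) n : 0 <= h -> 1 + n%:R * h <= (1 + h) ^+ n.
Proof.
move=> h0; elim: n => [|n IH]; first by rewrite mul0r addr0 expr0.
rewrite exprS -natr1.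
have : (1 + h) * (1 + n%:R * h) <= (1 + h) * (1 + h) ^+ n.
  by rewrite ler_wpM2l // addr_ge0.
have : 0 <= n%:R * h * h by rewrite !mulr_ge0.
by lra.
Qed.

(** Bernoulli's inequality, cubed, beats any multiple of a square. *)
Lemma exp_beats_square (h C : R) (n0 : nat) : 0 < h -> 0 <= C -> exists2 J : nat,
  (n0 <= J)%N & C * J%:R ^+ 2 <= (1 + h) ^+ J.
Proof.
move=> h0 C0; have h3 : 0 < h ^+ 3 by rewrite exprn_gt0.
have B0 : 0 <= 9 * C / h ^+ 3 by rewrite divr_ge0 ?mulr_ge0 // ltW.
pose n := (n0 + Num.bound (9 * C / h ^+ 3))%N.
exists (3 * n)%N; first by rewrite /n; lia.
have hn : 9 * C <= n%:R * h ^+ 3.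
  rewrite -ler_pdivrMr //; apply: (le_trans (ltW (archi_boundP B0))).
  by rewrite ler_nat leq_addl.
have nh : n%:R * h <= (1 + h) ^+ n.
  by apply: le_trans (bernoulli_ineq n (ltW h0)); rewrite lerDr.
rewrite mulnC exprM natrM.
have nh0 : 0 <= n%:R * h by rewrite mulr_ge0 // ltW.
apply: (@le_trans _ _ ((n%:R * h) ^+ 3)); last first.
  by rewrite ler_pXn2r // nnegrE //; exact: le_trans nh.
have -> : (n%:R * h) ^+ 3 = n%:R ^+ 2 * (n%:R * h ^+ 3) by ring.
have -> : C * (n%:R * 3%:R) ^+ 2 = n%:R ^+ 2 * (9 * C) :> R by ring.
by rewrite ler_wpM2l // sqr_ge0.
Qed.

Lemma geometric_small (x e : R) : 0 < x < 1 -> 0 < e ->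
  exists n0, forall n, (n0 <= n)%N -> x ^+ n <= e.
Proof.
move=> /andP[x0 x1] e0.
have h0 : 0 < x^-1 - 1 by rewrite subr_gt0 invf_gt1.
have B0 : 0 <= (e * (x^-1 - 1))^-1 by rewrite invr_ge0 mulr_ge0 // ltW.
exists (Num.bound (e * (x^-1 - 1))^-1) => n hn.
have hn' : (e * (x^-1 - 1))^-1 <= n%:R.
  by apply: le_trans (ltW (archi_boundP B0)) _; rewrite ler_nat.
have := bernoulli_ineq n (ltW h0); rewrite subrKC => hb.
rewrite -[leLHS]invrK -exprVn -[leRHS]invrK lef_pV2 ?posrE ?exprn_gt0 ?invr_gt0 //.
apply: le_trans hb; apply: (@le_trans _ _ (n%:R * (x^-1 - 1))); last by rewrite lerDr.
by rewrite -ler_pdivrMr // -invfM.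
Qed.
End Auxiliary.

(** * Points coded by digits in a tree of intervals *)

Section IntervalTree.
Local Open Scope classical_set_scope.
Local Open Scope ring_scope.
Variable R : realType.

Lemma nested_intervals (lo hi : nat -> R) :
  (forall k, lo k <= hi k) -> (forall k, lo k <= lo k.+1) ->
  (forall k, hi k.+1 <= hi k) -> exists x, forall k, lo k <= x <= hi k.
Proof.
move=> lohi loS hiS.
have lom i j : (i <= j)%N -> lo i <= lo j.
  by move=> ij; apply: (@homo_leq _ lo <=%R) => //; exact: le_trans.
have him i j : (i <= j)%N -> hi j <= hi i.
  move=> ij; apply: (@homo_leq _ hi (fun x y => y <= x)) => //.
  by move=> y x z xy yz; exact: le_trans xy.
have lh i j : lo i <= hi j.
  apply: (le_trans (lom _ _ (leq_maxl i j))).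
  exact: (le_trans (lohi _) (him _ _ (leq_maxr i j))).
exists (sup (range lo)) => k; apply/andP; split.
  apply: ub_le_sup; last by exists k.
  by exists (hi 0%N) => _ [i _ <-].
apply: ge_sup; first by exists (lo 0%N); exists 0%N.
by move=> _ [i _ <-].
Qed.

Lemma truncn_mulD (z : R) N : (0 < N)%N -> 0 <= z ->
  (Num.trunc (z * N%:R) %/ N)%N = Num.trunc z.
Proof.
move=> N0 z0; apply/esym/truncn_def.
have N0' : 0 < N%:R :> R by rewrite ltr0n.
have /andP[h1 h2] := truncn_itv (mulr_ge0 z0 (ltW N0')).
set m := Num.trunc _ in h1 h2 *.
apply/andP; split.
  rewrite -(ler_pM2r N0') (le_trans _ h1) // -natrM ler_nat.
  exact: leq_divM.
rewrite -(ltr_pM2r N0') (lt_le_trans h2) // -natrM ler_nat.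
exact: ltn_ceil.
Qed.

(** Every t in [0, 1) is sent to the branch of the tree that follows the
    base N digits of t.  If the digits of t and t' first differ at place j + 1,
    then |t - t'| <= N^-j, while the two points lie in different children of
    the same node of generation j, hence are kappa rho^j apart.  The hypothesis
    1 <= N rho^a compares the two.  The predicate [ok] is the invariant of the
    nodes of a generation, and [E] records what a child gains over its parent. *)
Lemma cantor_tree (S : Type) (s0 : S) (lo hi : S -> R) (ok : nat -> S -> Prop)
    (E : nat -> S -> S -> Prop) (N : nat) (kappa rho a : R) :
  0 < kappa -> 0 < rho -> 0 < a -> (1 < N)%N -> 1 <= N%:R * rho `^ a ->
  ok 0%N s0 ->
  (forall k s, ok k s -> lo s <= hi s) ->
  (forall k s, ok k s -> exists f : nat -> S,
     (forall d, (d < N)%N -> [/\ ok k.+1 (f d), E k s (f d),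
         lo s <= lo (f d) & hi (f d) <= hi s]) /\
     (forall d e, (d < N)%N -> (e < N)%N -> d != e ->
        forall y z, lo (f d) <= y <= hi (f d) -> lo (f e) <= z <= hi (f e) ->
        kappa * rho ^+ k <= `|y - z|)) ->
  exists phi : R -> R,
    (forall t, exists sg : nat -> S, sg 0%N = s0 /\
       forall k, [/\ ok k (sg k), E k (sg k) (sg k.+1) & lo (sg k) <= phi t <= hi (sg k)])
    /\ (forall t t', 0 <= t < 1 -> 0 <= t' < 1 ->
         `|t - t'| <= (kappa^-1) `^ a * `|phi t - phi t'| `^ a).
Proof.
move=> k0 r0 a0 N1 Nr ok0 lohi step.
have N0 : (0 < N)%N by exact: ltnW.
have : forall ks : nat * S, exists f : nat -> S, ok ks.1 ks.2 ->
  (forall d, (d < N)%N -> [/\ ok ks.1.+1 (f d), E ks.1 ks.2 (f d),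
         lo ks.2 <= lo (f d) & hi (f d) <= hi ks.2]) /\
     (forall d e, (d < N)%N -> (e < N)%N -> d != e ->
        forall y z, lo (f d) <= y <= hi (f d) -> lo (f e) <= z <= hi (f e) ->
        kappa * rho ^+ ks.1 <= `|y - z|).
  move=> [k s]; have [h|h] := pselect (ok k s).
    by have [f hf] := step _ _ h; exists f.
  by exists (fun=> s0).
move=> /choice[F hF].
pose m (t : R) k := Num.trunc (t * N%:R ^+ k).
(* The digit at place k is the residue modulo N of the integral part of t N^k. *)
pose st t := fix st k := if k is j.+1 then F (j, st j) (m t j.+1 %% N)%N else s0.
have stok t k : ok k (st t k).
  elim: k => //= k IH.
  by have [/(_ _ (ltn_pmod (m t k.+1) N0)) []] := hF (k, st t k) IH.
have stS t k : [/\ E k (st t k) (st t k.+1),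
    lo (st t k) <= lo (st t k.+1) & hi (st t k.+1) <= hi (st t k)].
  by have [/(_ _ (ltn_pmod (m t k.+1) N0)) []] := hF (k, st t k) (stok t k).
have : forall t, exists x, forall k, lo (st t k) <= x <= hi (st t k).
  move=> t; apply: nested_intervals => k; first exact: lohi (stok t k).
    by case: (stS t k).
  by case: (stS t k).
move=> /choice[phi hphi]; exists phi; split.
  by move=> t; exists (st t); split => // k; split => //; case: (stS t k).
have mS t k : 0 <= t -> (m t k.+1 %/ N)%N = m t k.
  move=> t0; rewrite /m exprSr mulrA truncn_mulD //.
  by rewrite mulr_ge0 // exprn_ge0.
have N0' : 0 < N%:R :> R by rewrite ltr0n.
have NX0 k : 0 < N%:R ^+ k :> R by rewrite exprn_gt0.
move=> t t' /andP[t0 t1] /andP[t'0 t'1].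
have [->|tt'] := eqVneq t t'.
  by rewrite subrr normr0 mulr_ge0 // powR_ge0.
have mitv k x : 0 <= x -> (m x k)%:R <= x * N%:R ^+ k < (m x k)%:R + 1.
  move=> x0; have /truncn_itv := mulr_ge0 x0 (ltW (NX0 k)).
  by rewrite -[in X in _ && X -> _]addn1 natrD.
have meq k : m t k = m t' k -> `|t - t'| <= (N%:R ^+ k)^-1.
  move=> e; have /andP[h1 h2] := mitv k _ t0.
  have /andP[h3 h4] := mitv k _ t'0.
  rewrite e in h1 h2.
  rewrite -[leRHS]mul1r ler_pdivlMr // -[X in _ * X]gtr0_norm // -normrM.
  by rewrite mulrBl ler_norml; apply/andP; split; lra.
(* Some digit differs, as N^-k tends to 0. *)
have exk : exists k, m t k != m t' k.
  apply/not_existsP => h.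
  have h' k : m t k = m t' k by apply/eqP; apply/negPn/negP; exact: h.
  have d0 : 0 < `|t - t'| by rewrite normr_gt0 subr_eq0.
  have := archi_boundP (ltW (divr_gt0 ltr01 d0)).
  set n := Num.bound _ => hn.
  have := meq n (h' n).
  rewrite leNgt => /negP; apply.
  rewrite -[ltLHS]mul1r ltr_pdivrMr // mulrC -ltr_pdivrMr //.
  apply: (lt_le_trans hn); rewrite -natrX ler_nat.
  exact/ltnW/ltn_expl.
have /= := @ex_minnP _ exk; case=> [[|j] hj jmin].
  case/eqP: hj; rewrite /m !expr0 !mulr1.
  rewrite (@truncn_def _ t 0%N) ?(@truncn_def _ t' 0%N) //.
    by rewrite t'0.
  by rewrite t0.
have mle i : (i <= j)%N -> m t i = m t' i.
  move=> ij; apply/eqP; apply/negPn/negP => /jmin.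
  by rewrite leqNgt ltnS ij.
have steq i : (i <= j)%N -> st t i = st t' i.
  elim: i => //= i IH ij; rewrite mle // IH //; exact: ltnW.
have := hF (j, st t j) (stok t j); move=> [_].
move=> /(_ (m t j.+1 %% N)%N (m t' j.+1 %% N)%N).
rewrite !ltn_pmod // => /(_ isT isT) H.
have ne : (m t j.+1 %% N != m t' j.+1 %% N)%N.
  apply: contra hj => /eqP e; apply/eqP.
  by rewrite (divn_eq (m t j.+1) N) (divn_eq (m t' j.+1) N) e !mS // mle.
have ht' : lo (F (j, st t j) (m t' j.+1 %% N)%N) <= phi t' <=
    hi (F (j, st t j) (m t' j.+1 %% N)%N).
  by rewrite (steq j) //; exact: hphi t' j.+1.
have sep := H ne _ _ (hphi t j.+1) ht'.
rewrite /= in sep.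
apply: (le_trans (meq j (mle j (leqnn j)))).
rewrite -powRM ?invr_ge0 ?(ltW k0) //.
have kr : rho ^+ j <= kappa^-1 * `|phi t - phi t'|.
  by rewrite -ler_pdivrMl ?invr_gt0 // invrK.
apply: le_trans (ler_powR_base (ltW a0) _ kr); last by rewrite exprn_ge0 // ltW.
rewrite powRX ?(ltW r0) // -[leLHS]mul1r ler_pdivrMr // -exprMn mulrC.
exact: exprn_ege1.
Qed.
End IntervalTree.

(** * Hausdorff measure of a set parametrized by the unit square *)

Section Slicing.
Local Open Scope classical_set_scope.
Local Open Scope ring_scope.
Variable R : realType.
Notation mu := (@lebesgue_measure R).

(** Replacing a set of parameters by an interval centred at one of its
    points avoids all measurability questions, and costs a factor 2. *)
Lemma bounded_set_hull (V : set R) (r : R) : 0 <= r ->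
  (forall u v, V u -> V v -> `|u - v| <= r) ->
  exists W : set R, [/\ measurable W, V `<=` W, (mu W <= (2 * r)%:E)%E &
    (V = set0 -> W = set0)].
Proof.
move=> r0 hV; have [->|/set0P[u0 Vu0]] := eqVneq V set0.
  by exists set0; split => //; rewrite measure0 lee_fin mulr_ge0.
exists `[u0 - r, u0 + r]%classic; split.
- exact: measurable_itv.
- move=> u /(hV _ _ Vu0); rewrite ler_norml /= in_itv /= => /andP[h1 h2].
  by apply/andP; split; lra.
- rewrite lebesgue_measure_itv /=; case: ifP => _; last by rewrite lee_fin mulr_ge0.
  by rewrite -EFinB lee_fin; lra.
- by move=> V0; move: Vu0; rewrite V0.
Qed.

Variables (T : Type) (dist : T -> T -> R).
Hypothesis dist_ge0 : forall p q, 0 <= dist p q.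

Lemma dist_le_diameter (U : set T) d p q : diameter dist U = d%:E ->
  U p -> U q -> dist p q <= d.
Proof.
move=> hd Up Uq; rewrite -lee_fin -hd /diameter le_max; apply/orP; right.
by apply: ereal_sup_ubound; exists p => //; exists q.
Qed.

Lemma diameter_fin (U : set T) (d : R) : (diameter dist U <= d%:E)%E ->
  exists2 e : R, diameter dist U = e%:E & 0 <= e <= d.
Proof.
move=> h; have h0 : (0 <= diameter dist U)%E by rewrite /diameter le_max lexx.
have hf : diameter dist U \is a fin_num.
  by rewrite ge0_fin_numE // (le_lt_trans h) // ltry.
exists (fine (diameter dist U)); first by rewrite fineK.
by rewrite -!lee_fin fineK // h0.
Qed.

(** A product structure without product measures: the second parameter
    u codes a set that depends on t in an arbitrary way.  Given a cover by sets
    U_i of diameter d_i, let W_i be an interval around the t whose fibre meets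
    U_i, of length at most 2 C d_i^a.  On the fibre over t, the u sent to U_i
    lie in an interval of length 2 C d_i^b.  These intervals cover [0, 1),
    so that 1 <= sum_i 2 C d_i^b 1_(W_i)(t); integration over t gives
    1 <= 4 C^2 sum_i d_i^(a + b). *)
Lemma hausdorff_measure_param_neq0 (A : set T) (Phi : R -> R -> T) (a b C s : R) :
  0 < a -> 0 < b -> 0 < C -> s <= a + b ->
  (forall t u, 0 <= t < 1 -> 0 <= u < 1 -> A (Phi t u)) ->
  (forall t t' u u', 0 <= t < 1 -> 0 <= t' < 1 -> 0 <= u < 1 -> 0 <= u' < 1 ->
     `|t - t'| <= C * dist (Phi t u) (Phi t' u') `^ a) ->
  (forall t u u', 0 <= t < 1 -> 0 <= u < 1 -> 0 <= u' < 1 ->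
     `|u - u'| <= C * dist (Phi t u) (Phi t u') `^ b) ->
  hausdorff_measure dist s A <> 0%E.
Proof.
move=> a0 b0 C0 sab hA ht hu h0.
(* The final estimate makes the sum of the gauges of any cover at least e. *)
pose e := (4 * C ^+ 2)^-1.
have e0 : 0 < e by rewrite invr_gt0 mulr_gt0 // exprn_gt0.
have : (hausdorff_premeasure dist s 1 A < e%:E)%E.
  apply: (@le_lt_trans _ _ 0%E); last by rewrite lte_fin.
  by rewrite -h0; apply: ereal_sup_ubound; exists 1 => //=.
move=> /ereal_inf_lt[_ [U [cov Ud] <-]].
apply/negP; rewrite -leNgt.
have /choice[D hD] : forall i, exists d : R, diameter dist (U i) = d%:E /\ 0 <= d <= 1.
  by move=> i; have [d h1 h2] := diameter_fin (Ud i); exists d.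
have dle i p q : U i p -> U i q -> dist p q <= D i.
  by apply: dist_le_diameter; case: (hD i).
have D0 i : 0 <= D i by case: (hD i) => _ /andP[].
pose I := [set t : R | 0 <= t < 1].
have IE : I = `[0, 1[%classic by apply/seteqP; split=> x /=; rewrite in_itv.
have mI : measurable I by rewrite IE; exact: measurable_itv.
have muI : mu I = 1%E.
  by rewrite IE lebesgue_measure_itv /= lte_fin ltr01 sube0.
pose V i := [set t | I t /\ exists2 u, I u & U i (Phi t u)].
have /choice[W hW] : forall i, exists W : set R, [/\ measurable W, V i `<=` W,
    (mu W <= (2 * (C * D i `^ a))%:E)%E & (V i = set0 -> W = set0)].
  move=> i; apply: bounded_set_hull; first by rewrite mulr_ge0 ?powR_ge0 // ltW.
  move=> t t' [It [u Iu Uu]] [It' [u' Iu' Uu']].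
  apply: (le_trans (ht _ _ _ _ It It' Iu Iu')).
  rewrite ler_pM2l //; apply: ler_powR_base => //; [exact: ltW | exact: dle].
pose k i := 2 * (C * D i `^ b).
have k0 i : 0 <= k i by rewrite mulr_ge0 // mulr_ge0 ?powR_ge0 // ltW.
have slice t : I t -> (1 <= \sum_(i <oo) ((k i)%:E * (\1_(W i) t)%:E))%E.
  move=> It.
  pose Z i := [set u | I u /\ U i (Phi t u)].
  have /choice[Y hY] : forall i, exists W : set R, [/\ measurable W, Z i `<=` W,
      (mu W <= (k i)%:E)%E & (Z i = set0 -> W = set0)].
    move=> i; apply: bounded_set_hull; first by rewrite mulr_ge0 ?powR_ge0 // ltW.
    move=> u u' [Iu Uu] [Iu' Uu'].
    apply: (le_trans (hu _ _ _ It Iu Iu')).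
    by rewrite ler_pM2l //; apply: ler_powR_base => //; [exact: ltW | exact: dle].
  rewrite -muI; apply: (@le_trans _ _ (\sum_(i <oo) mu (Y i))%E).
    apply: measure_sigma_subadditive => //; first by move=> i; case: (hY i).
    move=> u Iu; have [i _ Ui] := cov _ (hA _ _ It Iu).
    by exists i => //; case: (hY i) => _ + _ _; apply.
  apply: lee_nneseries => // i _.
  case: (hY i) => _ _ hk hz; rewrite indicE.
  have [tW|tW] := boolP (t \in W i); first by rewrite mule1.
  rewrite mule0 hz ?measure0 //; apply/seteqP; split => // u [Iu Uu].
  move: tW; rewrite notin_setE; apply; case: (hW i) => _ + _ _; apply.
  by split => //; exists u.
have mW i : measurable (W i) by case: (hW i).
have mf i : measurable_fun I (\1_(W i) : R -> R).
  exact: measurable_indic.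
have mkf i : measurable_fun I (fun t : R => k i * \1_(W i) t).
  exact: measurable_funM.
have kf0 i t : (0 <= (k i)%:E * (\1_(W i) t)%:E)%E.
  by rewrite -EFinM lee_fin mulr_ge0.
have int : (1 <= \sum_(i <oo) \int[mu]_(t in I) ((k i)%:E * (\1_(W i) t)%:E))%E.
  rewrite -integral_nneseries //; last first.
    by move=> i; apply/(measurable_EFinP _ (fun t : R => k i * \1_(W i) t)).
  have <- : (\int[mu]_(t in I) (cst 1 t) = 1)%E.
    by rewrite integral_cst // mul1e.
  apply: ge0_le_integral => //.
  - have := @ge0_emeasurable_sum _ _ R I
      (fun i t => ((k i)%:E * (\1_(W i) t)%:E)%E) xpredT.
    apply => [i t _ _|i _] //.
    exact/(measurable_EFinP _ (fun t : R => k i * \1_(W i) t)).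
have bound i : (\int[mu]_(t in I) ((k i)%:E * (\1_(W i) t)%:E) <=
    (4 * C ^+ 2)%:E * hausdorff_gauge dist s (U i))%E.
  rewrite ge0_integralZl_EFin //; last by apply/measurable_EFinP; exact: mf.
  rewrite integral_indic; [|exact: mI|exact: mW].
  apply: (@le_trans _ _ ((k i)%:E * mu (W i))%E).
    apply: lee_wpmul2l; first by rewrite lee_fin.
    apply: le_measure; last exact: subIsetl.
      by apply: mem_set; exact: (measurableI _ _ (mW i) mI).
    exact: mem_set (mW i).
  rewrite /hausdorff_gauge; case: (hW i) => _ _ hk hz.
  case: pselect => Ui /=.
    rewrite hz ?measure0 ?mule0 //; apply/seteqP; split => // t [_ [u _]].
    by rewrite Ui.
  have [-> hd] := hD i; rewrite poweR_EFin -EFinM.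
  apply: (@le_trans _ _ ((k i)%:E * (2 * (C * D i `^ a))%:E)%E).
    by apply: lee_wpmul2l => //; rewrite lee_fin.
  rewrite -EFinM lee_fin /k.
  have -> : 2 * (C * D i `^ b) * (2 * (C * D i `^ a)) =
    4 * C ^+ 2 * (D i `^ a * D i `^ b) by ring.
  rewrite ler_pM2l ?mulr_gt0 ?exprn_gt0 //.
  rewrite -powRD; last by rewrite gt_eqF // addr_gt0.
  have [->|Di0] := eqVneq (D i) 0.
    by rewrite powR0 ?powR_ge0 // gt_eqF // addr_gt0.
  by apply: ger_powR => //; case/andP: hd => hd ->; rewrite lt_neqAle eq_sym Di0 hd.
have g0 i : (0 <= hausdorff_gauge dist s (U i))%E.
  by rewrite /hausdorff_gauge; case: pselect => [h|h]; [exact: lexx | exact: poweR_ge0].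
have : (1 <= (4 * C ^+ 2)%:E * \sum_(i <oo) hausdorff_gauge dist s (U i))%E.
  apply: (le_trans int); rewrite -nneseriesZl //.
  by apply: lee_nneseries => // i _ _; exact: integral_ge0.
rewrite /e => h.
by rewrite -[leLHS]mule1 lee_pdivrMl ?mulr_gt0 ?exprn_gt0 //.
Qed.

End Slicing.

(** * A large set of badly approximable numbers *)

Section BadTree.
Local Open Scope classical_set_scope.
Local Open Scope ring_scope.
Variable R : realType.

(** The constant 1/(4 r^2) is the largest for which the neighbourhoods of a
    fraction with q^2 >= r^k are not longer than a child of generation k + 1,
    of length 1/(2 r^(k + 2)). *)
Definition avoids_level (r : R) (k : nat) (x : R) := forall (p : int) (q : nat),
  (0 < q)%N -> r ^+ k <= q%:R ^+ 2 < r ^+ k.+1 ->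
  (4 * r ^+ 2 * q%:R ^+ 2)^-1 <= `|x - p%:~R / q%:R|.

(** The parent has length r h, and the K candidates are every other
    interval of length h in it.  Fractions of level k that endanger points of the
    parent are all equal, by [close_fractions] with B = r^(k + 1); the points
    endangered by a single fraction are less than h apart, hence belong to one
    candidate. *)
Lemma avoiding_children (K k : nat) (l : R) : (1 < K)%N ->
  let r := (2 * K)%:R : R in
  let h := (2 * r ^+ k.+2)^-1 in
  exists f : nat -> R,
    (forall d, (d < K.-1)%N -> [/\ l <= f d, f d + h <= l + r * h &
       forall x, f d <= x <= f d + h -> avoids_level r k x]) /\
    (forall d e, (d < K.-1)%N -> (e < K.-1)%N -> d != e ->
      forall y z, f d <= y <= f d + h -> f e <= z <= f e + h -> h <= `|y - z|).
Proof.
move=> K1 r h.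
have K0 : (0 < K)%N by exact: ltnW.
have r0 : 0 < r by rewrite ltr0n muln_gt0.
have rE : r = 2 * K%:R by rewrite /r natrM.
have r2 : 4 <= r by rewrite /r -[4]/(4%:R) ler_nat; lia.
clearbody r.
have rn0 : r != 0 by rewrite gt_eqF.
have h0 : 0 < h by rewrite invr_gt0 mulr_gt0 // exprn_gt0.
pose g (j : nat) := l + 2 * j%:R * h.
have gsep i j y z : (i < j)%N -> g i <= y <= g i + h -> g j <= z <= g j + h ->
    h <= z - y.
  rewrite /g => ij /andP[y1 y2] /andP[z1 z2].
  have ijR : i%:R + 1 <= j%:R :> R by rewrite natr1 ler_nat.
  have : 2 * (i%:R + 1) * h <= 2 * j%:R * h by rewrite ler_pM2r // ler_pM2l.
  by move: y2 z1; lra.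
have gsep' i j y z : i != j -> g i <= y <= g i + h -> g j <= z <= g j + h ->
    h <= `|y - z|.
  rewrite neq_ltn => /orP[] ij hy hz.
    have := gsep _ _ _ _ ij hy hz; rewrite distrC => /le_trans; apply.
    exact: ler_norm.
  have := gsep _ _ _ _ ij hz hy => /le_trans; apply.
  exact: ler_norm.
pose kill (_ : unit) (j : nat) := exists x, g j <= x <= g j + h /\ ~ avoids_level r k x.
have [||e he] := @select_survivors _ K K.-1 [:: tt] kill; last first.
-
    exists (fun d => g (e d)); split.
    move=> d dK; have [eK nk _] := he d dK; split.
    + by rewrite /g lerDl !mulr_ge0 // ltW.
    + have eR : (e d)%:R + 1 <= K%:R :> R by rewrite natr1 ler_nat.
      rewrite rE.
      have : 2 * ((e d)%:R + 1) * h <= 2 * K%:R * h by rewrite ler_pM2r // ler_pM2l.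
      by rewrite /g; lra.
    + move=> x hx; apply: contrapT => na.
      by apply: (nk tt); [rewrite mem_seq1 | exists x].
  move=> d d' dK d'K dd' y z hy hz.
  apply: gsep' hy hz; apply: contra dd' => /eqP ee; apply/eqP.
  by have [_ _] := he d dK; apply.
- by rewrite /= addn1 prednK.
move=> u us i j iK jK [x [hx]]; rewrite /avoids_level.
move=> /existsNP[p /existsNP[q /not_implyP[q0 /not_implyP[qB]]]].
move=> /negP; rewrite -ltNge => xp [x' [hx']].
move=> /existsNP[p' /existsNP[q' /not_implyP[q'0 /not_implyP[q'B]]]].
move=> /negP; rewrite -ltNge => xp'.
apply: contrapT => /eqP ij.
have hxx := gsep' _ _ _ _ ij hx hx'.
set B := r ^+ k.+1 in qB q'B.
have B0 : 0 < B by rewrite exprn_gt0.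
have hB : h = (2 * r * B)^-1 by rewrite /h /B exprS mulrA.
have small (q1 : nat) : (0 < q1)%N -> r ^+ k <= q1%:R ^+ 2 < B ->
    (4 * r ^+ 2 * q1%:R ^+ 2)^-1 <= h / 2.
  move=> q10 /andP[q1B _]; rewrite hB.
  have -> : (2 * r * B)^-1 / 2 = (4 * r * B)^-1.
    by field; rewrite rn0 gt_eqF.
  rewrite lef_pV2 ?posrE; last 2 first.
  - by rewrite !mulr_gt0 // ?exprn_gt0 // ltr0n.
  - by rewrite !mulr_gt0.
  have -> : 4 * r * B = 4 * r ^+ 2 * r ^+ k by rewrite /B exprS; ring.
  by rewrite ler_pM2l // mulr_gt0 // exprn_gt0.
have s1 := small q q0 qB; have s2 := small q' q'0 q'B.
have xB : `|x - x'| <= r * h.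
  have bnd jj y : (jj < K)%N -> g jj <= y <= g jj + h -> l <= y <= l + r * h.
    move=> jK' /andP[y1 y2].
    have eR : jj%:R + 1 <= K%:R :> R by rewrite natr1 ler_nat.
    have : 2 * (jj%:R + 1) * h <= 2 * K%:R * h by rewrite ler_pM2r // ler_pM2l.
    have : 0 <= 2 * jj%:R * h by rewrite !mulr_ge0 // ltW.
    rewrite rE; move: y1 y2; rewrite /g => *; apply/andP; split; lra.
  have /andP[] := bnd _ _ iK hx; have /andP[] := bnd _ _ jK hx'.
  by move=> *; rewrite ler_norml; apply/andP; split; lra.
have : p%:~R / q%:R = p'%:~R / q'%:R :> R.
  apply: (@close_fractions _ _ _ _ _ B) => //.
  - by case/andP: qB.
  - by case/andP: q'B.
  have -> : p%:~R / q%:R - p'%:~R / q'%:R =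
    - (x - p%:~R / q%:R) + (x - x') + (x' - p'%:~R / q'%:R) by ring.
  apply: (le_trans (ler_normD _ _)).
  apply: (le_trans (lerD (ler_normD _ _) (lexx _))); rewrite normrN.
  have -> : B^-1 = 2 * r * h by rewrite hB; field; rewrite rn0 gt_eqF.
  have : 4 * h <= r * h by rewrite ler_pM2r.
  lra.
move=> pp; move: hxx; apply/negP; rewrite -ltNge.
have -> : x - x' = (x - p%:~R / q%:R) - (x' - p'%:~R / q'%:R) by rewrite pp; ring.
by apply: (le_lt_trans (ler_normB _ _)); lra.
Qed.

Lemma avoids_dist_int (K : nat) (x : R) : (1 < K)%N ->
  (forall k, avoids_level (2 * K)%:R k x) ->
  forall q : nat, (0 < q)%N ->
    (4 * (2 * K)%:R ^+ 2)^-1 * q%:R^-1 <= dist_int (q%:R * x).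
Proof.
move=> K1 hx q q0; apply: dist_int_ge => p.
have qR : 0 < q%:R :> R by rewrite ltr0n.
have r1 : (1 < 2 * K)%N by lia.
have q2 : (0 < q ^ 2)%N by rewrite expn_gt0 q0.
have /andP[h1 h2] := trunc_log_bounds r1 q2.
have h := hx (trunc_log (2 * K) (q ^ 2)) p q q0.
have {}h := h ltac:(by rewrite -!natrX ler_nat ltr_nat h1 h2).
move: h; set r := (2 * K)%:R : R.
have r0 : r != 0 by rewrite gt_eqF // ltr0n; lia.
clearbody r => h.
have -> : q%:R * x - p%:~R = q%:R * (x - p%:~R / q%:R).
  by field; rewrite gt_eqF.
rewrite normrM gtr0_norm // mulrC -ler_pdivrMl //.
apply: le_trans h; rewrite le_eqVlt; apply/orP; left; apply/eqP.
by field; rewrite r0 gt_eqF.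
Qed.

Theorem bad_parametrization (a : R) : 0 < a < 1 ->
  exists c C : R, exists phi : R -> R, [/\ 0 < c, 0 < C,
    (forall t (q : nat), (0 < q)%N -> c * q%:R^-1 < dist_int (q%:R * phi t)) &
    (forall t t', 0 <= t < 1 -> 0 <= t' < 1 ->
         `|t - t'| <= C * `|phi t - phi t'| `^ a)].
Proof.
move=> ha; have /andP[a0 a1] := ha.
have [m0 hm0] := @powR_le_linear R a 4 ha ltac:(by []).
(* There are K - 1 children and r = 2K <= 4 (K - 1). *)
pose K := (m0 + 3)%N; pose r : R := (2 * K)%:R.
have K1 : (1 < K)%N by rewrite /K; lia.
have r0 : 0 < r by rewrite ltr0n; lia.
have rK : 1 <= K.-1%:R * (r^-1) `^ a.
  have h := hm0 K.-1 ltac:(rewrite /K; lia).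
  rewrite -[leLHS](@powR_inv_mul _ r a r0) ler_wpM2r ?powR_ge0 //.
  apply: le_trans h; apply: ler_powR_base; [exact: ltW | exact: ltW |].
  by rewrite /r -natrM ler_nat; lia.
pose len k : R := (2 * r ^+ k.+1)^-1.
have len0 k : 0 < len k by rewrite invr_gt0 mulr_gt0 // exprn_gt0.
have lenS k : len k = r * len k.+1.
  have gen (z w : R) : z != 0 -> w != 0 -> (2 * w)^-1 = z * (2 * (z * w))^-1.
    by move=> z0 w0; field; rewrite z0 w0.
  rewrite /len [in RHS]exprS; apply: gen; first by rewrite gt_eqF.
  by rewrite gt_eqF // exprn_gt0.
have k0 : 0 < (2 * r ^+ 2)^-1 by rewrite invr_gt0 mulr_gt0 // exprn_gt0.
have [|||k s hs|k s hs|phi [h1 h2]] := @cantor_tree R (R * R)%type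
  (0, len 0%N) fst snd (fun k s => s.2 = s.1 + len k)
  (fun k s s' => forall x, s'.1 <= x <= s'.2 -> avoids_level r k x)
  K.-1 ((2 * r ^+ 2)^-1) (r^-1) a k0 _ a0 _ rK.
- by rewrite invr_gt0.
- by rewrite /K; lia.
- by rewrite /= add0r.
- by rewrite hs lerDl ltW.
- have [f [f1 f2]] := avoiding_children k s.1 K1.
  exists (fun d => (f d, f d + len k.+1)); split.
    move=> d dK; have [g1 g2 g3] := f1 d dK; split => //.
    by rewrite /= hs (lenS k); exact: g2.
  move=> d e dK eK de y z hy hz.
  apply: le_trans (f2 d e dK eK de y z hy hz).
  rewrite exprVn -invfM le_eqVlt; apply/orP; left; apply/eqP.
  by congr (_^-1); rewrite !exprS; ring.
exists ((4 * r ^+ 2)^-1 / 2), ((2 * r ^+ 2)^-1^-1 `^ a), phi.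
have c0 : 0 < (4 * r ^+ 2)^-1 by rewrite invr_gt0 mulr_gt0 // exprn_gt0.
split => //.
- by rewrite divr_gt0.
- by rewrite powR_gt0 // invr_gt0.
move=> t q q0.
have [sg [_ hs]] := h1 t.
have av k : avoids_level r k (phi t).
  have [_ he _] := hs k; have [_ _ hb] := hs k.+1; exact: he.
apply: lt_le_trans (avoids_dist_int K1 av q0).
rewrite ltr_pM2r ?invr_gt0 ?ltr0n // ltr_pdivrMr // ltr_pMr //.
by rewrite -[1]/(1%:R) ltr_nat.
Qed.
End BadTree.

(** * Moebius images of an interval of complete quotients *)

Section Moebius.
Local Open Scope classical_set_scope.
Local Open Scope ring_scope.
Variable R : realType.
Notation state := ((int * int) * (int * int))%type.

(** The number whose expansion has reached the state st and has the complete
    quotient b next. *)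
Definition moebius (st : state) (b : R) : R :=
  (b * st.2.1%:~R + st.1.1%:~R) / (b * st.2.2%:~R + st.1.2%:~R).

(** Holds for every state but the initial one, provided that the partial
    quotients after the first are positive. *)
Definition regular_state (st : state) :=
  [/\ 1 <= st.2.2, 0 <= st.1.2 <= st.2.2 & conv_det st = 1 \/ conv_det st = -1].

Lemma regular_denom_gt0 st : regular_state st -> 0 < st.2.2%:~R :> R.
Proof. by case=> q1 _ _; rewrite ltr0z; apply: lt_le_trans q1. Qed.

Lemma regular_step st (a : int) : 1 <= a -> regular_state st ->
  regular_state (conv_step st a).
Proof.
case: st => [[p' q'] [p q]] a1 [/= q1 /andP[q'0 q'q] hd]; split => /=; try nia.
rewrite conv_det_step; case: hd => ->; [by right | by left].
Qed.

Lemma moebius_denom_gt0 st (b : R) : regular_state st -> 0 < b ->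
  0 < b * st.2.2%:~R + st.1.2%:~R.
Proof.
move=> [q1 /andP[q'0 _] _] b0; apply: ltr_pwDl; last by rewrite ler0z.
by rewrite mulr_gt0 // ltr0z; lia.
Qed.

Lemma moebiusB st (b g : R) : regular_state st -> 0 < b -> 0 < g ->
  moebius st b - moebius st g = (conv_det st)%:~R * (b - g) /
   ((b * st.2.2%:~R + st.1.2%:~R) * (g * st.2.2%:~R + st.1.2%:~R)).
Proof.
move=> hs b0 g0; have h1 := moebius_denom_gt0 hs b0; have h2 := moebius_denom_gt0 hs g0.
rewrite /moebius /conv_det rmorphB !rmorphM /=.
by field; rewrite !gt_eqF.
Qed.

Lemma moebius_inj st (b g : R) : regular_state st -> 0 < b -> 0 < g ->
  moebius st b = moebius st g -> b = g.
Proof.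
move=> hs b0 g0 /eqP; rewrite -subr_eq0 moebiusB //.
have h1 := moebius_denom_gt0 hs b0; have h2 := moebius_denom_gt0 hs g0.
rewrite mulf_eq0 invr_eq0 mulf_eq0 [X in _ || X]gt_eqF ?mulr_gt0 // orbF.
case: hs => _ _ [] ->; rewrite ?oppr_eq0 oner_eq0 /= subr_eq0 => /eqP //.
Qed.

Lemma moebius_step st (a : int) (b : R) : regular_state st -> 1 <= a -> 0 < b ->
  moebius (conv_step st a) b = moebius st (a%:~R + b^-1).
Proof.
move=> hs a1 b0; rewrite /moebius /= !rmorphD !rmorphM /=.
have bn0 : b != 0 by rewrite gt_eqF.
have scale (z w : R) : b * (a%:~R * z + w) + z = b * ((a%:~R + b^-1) * z + w).
  by field.
by rewrite !scale -mulf_div divff // mul1r.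
Qed.

(** The node of st consists of the numbers whose next complete quotient lies
    in [M, 2M].  Its endpoints come in an order that depends on the sign of the
    determinant. *)
Definition node_lo (M : R) st := Num.min (moebius st M) (moebius st (2 * M)).
Definition node_hi (M : R) st := Num.max (moebius st M) (moebius st (2 * M)).

Lemma node_lo_hi M st : node_lo M st <= node_hi M st.
Proof. by rewrite /node_lo /node_hi ge_min le_max lexx. Qed.

Lemma moebius_in_node (M b : R) st : regular_state st -> 0 < M -> M <= b <= 2 * M ->
  node_lo M st <= moebius st b <= node_hi M st.
Proof.
move=> hs M0 /andP[b1 b2].
have b0 : 0 < b by exact: lt_le_trans b1.
have M20 : 0 < 2 * M by rewrite mulr_gt0.
have h1 := moebiusB hs b0 M0; have h2 := moebiusB hs M20 b0.
have u0 := moebius_denom_gt0 hs b0; have v0 := moebius_denom_gt0 hs M0.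
have w0 := moebius_denom_gt0 hs M20.
set u := b * _ + _ in u0 h1 h2; set v := M * _ + _ in v0 h1.
set w := 2 * M * _ + _ in w0 h2.
have p1 : 0 <= (b - M) / (u * v) by rewrite divr_ge0 ?subr_ge0 // mulr_ge0 // ltW.
have p2 : 0 <= (2 * M - b) / (w * u) by rewrite divr_ge0 ?subr_ge0 // mulr_ge0 // ltW.
rewrite /node_lo /node_hi ge_min le_max.
case: hs => _ _ [] hd; rewrite hd ?mul1r ?mulN1r ?mulNr in h1 h2.
  by apply/andP; split; apply/orP; [left | right]; lra.
by apply/andP; split; apply/orP; [right | left]; lra.
Qed.

(** The complete quotient is recovered as b = (y q' - p') / (p - y q), where
    p - y q has the sign of the determinant on the whole node. *)
Lemma in_node_moebius (M y : R) st : regular_state st -> 0 < M ->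
  node_lo M st <= y <= node_hi M st ->
  exists2 b, M <= b <= 2 * M & y = moebius st b.
Proof.
move=> hs M0; have M20 : 0 < 2 * M by rewrite mulr_gt0.
have h1 := moebius_denom_gt0 hs M0; have h2 := moebius_denom_gt0 hs M20.
have hB := moebiusB hs M20 M0.
have q0 := regular_denom_gt0 hs.
set q : R := st.2.2%:~R in q0 h1 h2 hB; set q' : R := st.1.2%:~R in h1 h2 hB.
pose p : R := st.2.1%:~R; pose p' : R := st.1.1%:~R.
have E (b : R) : moebius st b = (b * p + p') / (b * q + q') by [].
have hD : p * q' - p' * q = (conv_det st)%:~R by rewrite /conv_det rmorphB !rmorphM.
have pos : 0 < (2 * M - M) / ((2 * M * q + q') * (M * q + q')).
  by rewrite divr_gt0 ?mulr_gt0 //; lra.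
rewrite /node_lo /node_hi.
have fin : forall s : R, s = 1 \/ s = -1 -> p * q' - p' * q = s ->
   0 < s * (p - y * q) -> 0 <= s * (y * (M * q + q') - (M * p + p')) ->
   0 <= s * ((2 * M * p + p') - y * (2 * M * q + q')) ->
   exists2 b, M <= b <= 2 * M & y = moebius st b.
  move=> s hs1 hs2 g1 g2 g3.
  have nz : p - y * q != 0 by apply: contraTneq g1 => ->; rewrite mulr0 ltxx.
  have sb : (y * q' - p') / (p - y * q) = (s * (y * q' - p')) / (s * (p - y * q)).
    have snz : s != 0 by case: hs1 => ->; rewrite ?oppr_eq0 oner_eq0.
    by rewrite -mulf_div divff // mul1r.
  exists ((y * q' - p') / (p - y * q)).
    by rewrite sb ler_pdivlMr // ler_pdivrMr //; apply/andP; split; lra.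
  rewrite E.
  have dn : (y * q' - p') * q + q' * (p - y * q) = s by rewrite -hs2; ring.
  have -> : (y * q' - p') / (p - y * q) * q + q' = s / (p - y * q).
    by rewrite -dn; field.
  have -> : (y * q' - p') / (p - y * q) * p + p' = y * s / (p - y * q).
    by rewrite -hs2; field.
  have snz : s != 0 by case: hs1 => ->; rewrite ?oppr_eq0 oner_eq0.
  by field; rewrite snz nz.
have m1 : moebius st M * (M * q + q') = M * p + p' by rewrite E divfK // gt_eqF.
have m2 : moebius st (2 * M) * (2 * M * q + q') = 2 * M * p + p'.
  by rewrite E divfK // gt_eqF.
case: (hs) => _ _ [] hd; rewrite hd in hD hB; move: hB;
  rewrite ?mul1r ?mulN1r ?mulNr => hB.
- rewrite min_l; last by move: pos; rewrite -hB; lra.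
  rewrite max_r; last by move: pos; rewrite -hB; lra.
  move=> /andP[y1 y2]; apply: (fin 1) => //; first by left.
  + have : y * (2 * M * q + q') <= 2 * M * p + p' by rewrite -m2 ler_pM2r.
    move=> z; rewrite mul1r -(pmulr_rgt0 _ h2).
    have -> : (2 * M * q + q') * (p - y * q) = (p * q' - p' * q) +
       q * (2 * M * p + p' - y * (2 * M * q + q')) by ring.
    by rewrite hD; apply: ltr_pwDl => //; rewrite mulr_ge0 ?subr_ge0 // ltW.
  + by rewrite mul1r subr_ge0 -m1 ler_pM2r.
  + by rewrite mul1r subr_ge0 -m2 ler_pM2r.
- rewrite min_r; last by move: pos hB; lra.
  rewrite max_l; last by move: pos hB; lra.
  move=> /andP[y1 y2]; apply: (fin (-1)) => //; first by right.
  + have : 2 * M * p + p' <= y * (2 * M * q + q') by rewrite -m2 ler_pM2r.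
    move=> z; rewrite mulN1r -(pmulr_rgt0 _ h2).
    have -> : (2 * M * q + q') * - (p - y * q) = - (p * q' - p' * q) +
       q * (y * (2 * M * q + q') - (2 * M * p + p')) by ring.
    by rewrite hD opprK; apply: ltr_pwDl => //; rewrite mulr_ge0 ?subr_ge0 // ltW.
  + by rewrite mulN1r opprB subr_ge0 -m1 ler_pM2r.
  + by rewrite mulN1r opprB subr_ge0 -m2 ler_pM2r.
Qed.
End Moebius.

(** * Denominators at which a badly approximable number is close to an integer *)

Section Lacunary.
Local Open Scope classical_set_scope.
Local Open Scope ring_scope.
Variable R : realType.

(** Every convergent denominator of x satisfies this condition, and it is
    easier to count than the property of being one. *)
Definition near_denom (x : R) (q : nat) :=
  (0 < q)%N /\ exists p : int, `|q%:R * x - p%:~R| <= q%:R^-1.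

Definition badly_approx (c x : R) :=
  forall q : nat, (0 < q)%N -> c * q%:R^-1 < dist_int (q%:R * x).

(** The difference of two such denominators q < r is again a good
    denominator, ||(r - q) x|| <= 2/q, so that bad approximability forces
    r - q >= c q / 2. *)
Lemma near_denom_gap (c x : R) (q r : nat) : 0 < c -> badly_approx c x ->
  near_denom x q -> near_denom x r -> (q < r)%N ->
  (1 + c / 2) * q%:R <= r%:R.
Proof.
move=> c0 hx [q0 [p hp]] [r0 [s hs]] qr.
have qR : 0 < q%:R :> R by rewrite ltr0n.
have qr0 : (0 < r - q)%N by rewrite subn_gt0.
have dR : 0 < (r - q)%:R :> R by rewrite ltr0n.
have := hx _ qr0 => /lt_le_trans /(_ (dist_int_le _ (s - p))).
have -> : (r - q)%:R * x - (s - p)%:~R =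
    (r%:R * x - s%:~R) - (q%:R * x - p%:~R) :> R.
  by rewrite natrB ?(ltnW qr) // rmorphB /=; ring.
move=> /lt_le_trans /(_ (ler_normB _ _)) => h.
have rq : r%:R^-1 <= q%:R^-1 :> R.
  by rewrite lef_pV2 ?posrE ?ltr0n // ler_nat ltnW.
have {}h : c / (r - q)%:R < 2 / q%:R.
  apply: (lt_le_trans h); have -> : 2 / q%:R = q%:R^-1 + q%:R^-1 :> R by lra.
  exact: lerD (le_trans hs rq) hp.
move: h; rewrite ltr_pdivrMr // mulrAC ltr_pdivlMr // natrB ?(ltnW qr) //.
lra.
Qed.

Lemma path_geometric (lam : R) (q : nat) (s : seq nat) : 0 < lam ->
  path (fun a b : nat => lam * a%:R <= b%:R) q s ->
  lam ^+ size s * q%:R <= (last q s)%:R.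
Proof.
move=> l0; elim: s q => [|r s IH] q /=; first by rewrite expr0 mul1r.
move=> /andP[qr /IH]; apply: le_trans.
by rewrite exprSr -mulrA ler_pM2l // exprn_gt0.
Qed.

Lemma near_denom_block (c x A B : R) (J : nat) : 0 < c -> badly_approx c x ->
  0 < A -> B <= (1 + c / 2) ^+ J * A ->
  exists s : seq nat, (size s <= J)%N /\
    forall q, q \in s <-> near_denom x q /\ A <= q%:R < B.
Proof.
move=> c0 hx A0 AB; set lam := 1 + c / 2 in AB.
have l1 : 1 <= lam by rewrite /lam; lra.
have l0 : 0 < lam by exact: lt_le_trans l1.
pose P q := `[< near_denom x q /\ A <= q%:R < B >].
pose s := [seq q <- iota 0 (Num.bound B).+1 | P q].
have hs q : q \in s <-> near_denom x q /\ A <= q%:R < B.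
  rewrite mem_filter mem_iota /= add0n; split; first by move=> /andP[/asboolP].
  move=> h; rewrite /P asboolT //=; case: h => _ /andP[h1 h2].
  have B0 : 0 <= B by apply: ltW; apply: lt_trans h2; exact: lt_le_trans h1.
  rewrite ltnS -(ler_nat R); apply: ltW; apply: (lt_trans h2).
  exact: archi_boundP.
exists s; split => //.
have srt : sorted ltn s by apply: sorted_filter; [exact: ltn_trans | exact: iota_ltn_sorted].
case E : s => [|q s'] //=.
rewrite leqNgt; apply/negP; rewrite ltnS => sz.
have pth : path (fun a b : nat => lam * a%:R <= b%:R) q s'.
  move: srt; rewrite E /=.
  have : {subset q :: s' <= s} by rewrite E.
  clear E sz; elim: s' q => //= r s' IH q sub /andP[qr pr].
  have [nq _] : near_denom x q /\ A <= q%:R < B by apply/hs/sub; rewrite mem_head.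
  have [nr _] : near_denom x r /\ A <= r%:R < B.
    by apply/hs/sub; rewrite !inE eqxx orbT.
  rewrite (near_denom_gap c0 hx nq nr qr) IH // => z zs.
  by apply: sub; rewrite inE zs orbT.
have [_ /andP[Aq _]] : near_denom x q /\ A <= q%:R < B by apply/hs; rewrite E mem_head.
have [_ /andP[_ lB]] : near_denom x (last q s') /\ A <= (last q s')%:R < B.
  by apply/hs; rewrite E mem_last.
have := path_geometric l0 pth; apply/negP; rewrite -ltNge.
apply: (lt_le_trans lB); apply: (le_trans AB).
apply: (@le_trans _ _ (lam ^+ size s' * A)).
  by rewrite ler_pM2r // ler_weXn2l.
by rewrite ler_pM2l // exprn_gt0.
Qed.

(** Otherwise the two steps of length th would both be equal, modulo 1, to the
    same number of absolute value at least e, and the first and last points would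
    be at least 2 e apart, although both are within e of an integer.  The
    assumption e <= 1/4 excludes that the two steps differ by a nonzero integer. *)
Lemma one_of_three (e u th : R) : e <= 4^-1 -> e <= dist_int th ->
  [\/ e <= dist_int u, e <= dist_int (u + th) | e <= dist_int (u + 2 * th)].
Proof.
move=> e4 hth.
have [|/dist_int_lt[m0 h0]] := leP e (dist_int u); first by constructor 1.
have [|/dist_int_lt[m1 h1]] := leP e (dist_int (u + th)); first by constructor 2.
have [|/dist_int_lt[m2 h2]] := leP e (dist_int (u + 2 * th)); first by constructor 3.
exfalso.
have hm := le_trans hth (dist_int_le _ (m1 - m0)).
move: h0 h1 h2; rewrite !ltr_norml => /andP[a1 a2] /andP[b1 b2] /andP[c1 c2].
have : `|(m2 - m1 - (m1 - m0))%:~R : R| < 1.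
  by rewrite !rmorphB /= ltr_norml; apply/andP; split; lra.
rewrite -intr_norm ltrz1 => hz.
have hz' : m2 - m1 - (m1 - m0) = 0 by move: hz; lia.
have {hz'} e2 : m2%:~R = 2 * m1%:~R - m0%:~R :> R.
  have -> : m2 = m1 + m1 - m0 by move: hz'; lia.
  by rewrite rmorphB rmorphD /=; ring.
move: hm; rewrite rmorphB /=; apply/negP; rewrite -ltNge ltr_norml.
by apply/andP; split; lra.
Qed.
End Lacunary.

(** * One generation of the tree of ordinates *)

Lemma group_digit (M g i : nat) : (i < 3)%N ->
  ((M + 3 * g)%:Z <= (M + 3 * g)%:Z + i%:Z < (M + 3 * g.+1)%:Z)%R.
Proof. by move=> i3; apply/andP; split; lia. Qed.

Lemma group_window (J g : nat) (a : int) : (g < 2 * J)%N ->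
  ((6 * J + 3 * g)%:Z <= a < (6 * J + 3 * g.+1)%:Z)%R ->
  ((6 * J)%:Z <= a < (2 * (6 * J))%:Z)%R.
Proof. by move=> gJ /andP[h1 h2]; apply/andP; split; lia. Qed.

Lemma group_inj (M g h : nat) (a : int) :
  ((M + 3 * g)%:Z <= a < (M + 3 * g.+1)%:Z)%R ->
  ((M + 3 * h)%:Z <= a < (M + 3 * h.+1)%:Z)%R -> g = h.
Proof. by move=> /andP[h1 h2] /andP[h3 h4]; lia. Qed.

Lemma eq_int_of_close (R : realType) (i j : int) :
  (`|(i - j)%:~R : R| < 1)%R -> i = j.
Proof. by rewrite -intr_norm ltrz1; lia. Qed.

Section Children.
Local Open Scope classical_set_scope.
Local Open Scope ring_scope.
Variable R : realType.
Notation state := ((int * int) * (int * int))%type.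
Variable M : nat.
Hypothesis M2 : (2 <= M)%N.
Notation m := (M%:R : R).
Notation in_node st y := (node_lo m st <= y <= node_hi m st).

Let m2 : 2 <= m. Proof. by rewrite -[2]/(2%:R) ler_nat. Qed.
Let m0 : 0 < m. Proof. by apply: lt_le_trans m2. Qed.

(** A digit a < 2M leaves room for the fractional part of the complete
    quotient: a + 1 <= 2M. *)
Lemma digit_bounds (a : int) : M%:Z <= a < (2 * M)%:Z ->
  [/\ 1 <= a, m <= a%:~R & a%:~R + 1 <= 2 * m].
Proof.
move=> /andP[a1 a2]; split.
- by move: M2 a1; lia.
- by rewrite pmulrn ler_int.
- have -> : 2 * m = (2 * M)%:R :> R by rewrite natrM.
  by rewrite pmulrn -[X in _ + X]/((1 : int)%:~R) -rmorphD ler_int; lia.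
Qed.

Lemma child_parameter (a : int) (b : R) : M%:Z <= a < (2 * M)%:Z -> m <= b <= 2 * m ->
  m <= a%:~R + b^-1 <= 2 * m /\ 0 < b^-1 <= 2^-1.
Proof.
move=> /digit_bounds[_ a1 a2] /andP[b1 b2].
have b0 : 0 < b by exact: lt_le_trans b1.
have i0 : 0 < b^-1 by rewrite invr_gt0.
have i1 : b^-1 <= 2^-1 by rewrite lef_pV2 ?posrE //; exact: le_trans b1.
by split; apply/andP; split => //; lra.
Qed.

Lemma child_subset st (a : int) : regular_state st -> M%:Z <= a < (2 * M)%:Z ->
  node_lo m st <= node_lo m (conv_step st a) /\
  node_hi m (conv_step st a) <= node_hi m st.
Proof.
move=> hs ha; have [a1 _ _] := digit_bounds ha.
have e b : m <= b <= 2 * m -> in_node st (moebius (conv_step st a) b).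
  move=> hb; rewrite moebius_step //; last by case/andP: hb => + _; exact: lt_le_trans.
  by apply: moebius_in_node => //; case: (child_parameter ha hb).
have /andP[u1 u2] : in_node st (moebius (conv_step st a) m).
  by apply: e; rewrite lexx /=; have := m0; lra.
have /andP[v1 v2] : in_node st (moebius (conv_step st a) (2 * m)).
  by apply: e; rewrite lexx andbT; have := m0; lra.
by rewrite {2}/node_lo {1}/node_hi le_min ge_max u1 u2 v1 v2.
Qed.

Lemma moebius_denom_bounds st (b : R) : regular_state st -> m <= b <= 2 * m ->
  m * st.2.2%:~R <= b * st.2.2%:~R + st.1.2%:~R <= 3 * m * st.2.2%:~R.
Proof.
move=> [q1 /andP[q'0 q'q] _] /andP[b1 b2].
have q0 : 0 <= st.2.2%:~R :> R by rewrite ler0z; lia.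
have q'R : 0 <= st.1.2%:~R :> R by rewrite ler0z.
have q'qR : st.1.2%:~R <= st.2.2%:~R :> R by rewrite ler_int.
have p1 : 0 <= (b - m) * st.2.2%:~R by rewrite mulr_ge0 // subr_ge0.
have p2 : 0 <= (2 * m - b) * st.2.2%:~R by rewrite mulr_ge0 // subr_ge0.
have p3 : 0 <= (m - 1) * st.2.2%:~R by rewrite mulr_ge0 //; have := m2; lra.
by apply/andP; split; lra.
Qed.

(** From the formula for the difference of two values of a Moebius map of
    determinant 1 or -1, whose denominators are between M q and 3 M q. *)
Lemma node_distance st (b g : R) : regular_state st ->
  m <= b <= 2 * m -> m <= g <= 2 * m ->
  `|b - g| / (9 * m ^+ 2 * st.2.2%:~R ^+ 2) <= `|moebius st b - moebius st g|
    <= (m * st.2.2%:~R ^+ 2)^-1.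
Proof.
move=> hs hb hg.
have b0 : 0 < b by case/andP: hb => + _; exact: lt_le_trans.
have g0 : 0 < g by case/andP: hg => + _; exact: lt_le_trans.
rewrite moebiusB // !normrM.
have -> : `|(conv_det st)%:~R : R| = 1.
  by case: hs => _ _ [] ->; rewrite ?normrN1 ?normr1.
have q0 : 0 < st.2.2%:~R :> R by exact: regular_denom_gt0.
have /andP[u1 u2] := moebius_denom_bounds hs hb.
have /andP[v1 v2] := moebius_denom_bounds hs hg.
set u := b * _ + _ in u1 u2 *; set v := g * _ + _ in v1 v2 *.
set q : R := st.2.2%:~R in q0 u1 u2 v1 v2 *.
have mq : 0 < m * q by rewrite mulr_gt0.
have u0 : 0 < u by exact: lt_le_trans u1.
have v0 : 0 < v by exact: lt_le_trans v1.
rewrite mul1r [`|(u * v)^-1|]gtr0_norm ?invr_gt0 ?mulr_gt0 //.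
apply/andP; split.
  apply: ler_wpM2l => //; rewrite lef_pV2 ?posrE ?mulr_gt0 ?exprn_gt0 //.
  have -> : 9 * m ^+ 2 * q ^+ 2 = (3 * m * q) * (3 * m * q) by ring.
  by apply: ler_pM => //; exact: ltW.
have bg : `|b - g| <= m.
  by move: hb hg => /andP[? ?] /andP[? ?]; rewrite ler_norml; apply/andP; split; lra.
rewrite ler_pdivrMr ?mulr_gt0 //; apply: (le_trans bg).
have e : (m * q ^+ 2)^-1 * ((m * q) * (m * q)) = m.
  by field; rewrite (gt_eqF q0) (gt_eqF m0).
rewrite -[leLHS]e.
apply: ler_wpM2l; first by rewrite invr_ge0 mulr_ge0 ?sqr_ge0 // ltW.
by apply: ler_pM => //; exact: ltW.
Qed.

(** Complete quotients with different integral parts a and b differ by at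
    least 1/2, as their fractional parts are at most 1/M <= 1/2. *)
Lemma child_separation st (a b : int) y z : regular_state st ->
  M%:Z <= a < (2 * M)%:Z -> M%:Z <= b < (2 * M)%:Z -> a != b ->
  in_node (conv_step st a) y -> in_node (conv_step st b) z ->
  (18 * m ^+ 2 * st.2.2%:~R ^+ 2)^-1 <= `|y - z|.
Proof.
move=> hs ha hb ab.
have [a1 _ _] := digit_bounds ha; have [b1 _ _] := digit_bounds hb.
move=> /(in_node_moebius (regular_step a1 hs) m0)[u hu ->].
move=> /(in_node_moebius (regular_step b1 hs) m0)[v hv ->].
have u0 : 0 < u by case/andP: hu => + _; exact: lt_le_trans.
have v0 : 0 < v by case/andP: hv => + _; exact: lt_le_trans.
rewrite !moebius_step //.
have [hu1 /andP[iu0 iu1]] := child_parameter ha hu.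
have [hv1 /andP[iv0 iv1]] := child_parameter hb hv.
have /andP[+ _] := node_distance hs hu1 hv1; apply: le_trans.
have q0 : 0 < st.2.2%:~R :> R by exact: regular_denom_gt0.
have -> : (18 * m ^+ 2 * st.2.2%:~R ^+ 2)^-1 =
  2^-1 / (9 * m ^+ 2 * st.2.2%:~R ^+ 2).
  by field; rewrite !gt_eqF.
apply: ler_wpM2r; first by rewrite invr_ge0 !mulr_ge0 ?(ltW q0).
have : 1 <= `|(a - b)%:~R : R|.
  by rewrite norm_intr_ge1 ?intr_eq0 ?subr_eq0 // rpred_int.
rewrite rmorphB /=; set A : R := a%:~R; set B : R := b%:~R => AB.
have : `|u^-1 - v^-1| <= 2^-1 by rewrite ler_norml; apply/andP; split; lra.
have -> : A + u^-1 - (B + v^-1) = (A - B) + (u^-1 - v^-1) by ring.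
have := lerB_normD (A - B) (u^-1 - v^-1).
lra.
Qed.

(** The 2J groups of three consecutive digits in [M, 2M) each contain a
    digit that keeps the new denominator q1 away from the bad values:
    c' <= ||q1 x||.  The denominators Q of x treated at this generation are
    those with q^2 / (18 M) <= Q < M q^2 / 2.  The upper bound makes the node
    shorter than 1/(2Q), so that only one integer can be close to Q y; the lower
    bound makes Q times the distance of two children at least 2 c'.  Hence Q
    spoils at most one group.  The endpoints of the range have the ratio 9 M^2,
    so that there are at most J such Q. *)
Lemma good_children (c c' x : R) (J : nat) st : M = (6 * J)%N ->
  0 < c -> badly_approx c x -> 0 < c' -> c' <= 4^-1 -> 648 * m ^+ 3 * c' <= 1 ->
  9 * m ^+ 2 <= (1 + c / 2) ^+ J ->
  regular_state st -> c' <= dist_int (st.2.2%:~R * x) ->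
  exists f : nat -> int,
    (forall d, (d < J)%N -> [/\ M%:Z <= f d < (2 * M)%:Z,
       c' <= dist_int ((conv_step st (f d)).2.2%:~R * x) &
       forall y Q, in_node (conv_step st (f d)) y -> near_denom x Q ->
         st.2.2%:~R ^+ 2 / (18 * m) <= Q%:R < m * st.2.2%:~R ^+ 2 / 2 ->
         c' <= dist_int (Q%:R * y)]) /\
    (forall d e, (d < J)%N -> (e < J)%N -> d != e -> f d != f e).
Proof.
move=> MJ c0 hx c'0 c'4 c'M lamJ hs hq.
have q0 : 0 < st.2.2%:~R :> R by exact: regular_denom_gt0.
set q : R := st.2.2%:~R in q0 hq *.
have [s [sJ hsQ]] : exists s : seq nat, (size s <= J)%N /\
    forall Q, Q \in s <-> near_denom x Q /\ q ^+ 2 / (18 * m) <= Q%:R < m * q ^+ 2 / 2.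
  apply: (near_denom_block c0 hx); first by rewrite divr_gt0 ?exprn_gt0 ?mulr_gt0.
  have -> : m * q ^+ 2 / 2 = 9 * m ^+ 2 * (q ^+ 2 / (18 * m)).
    by field; rewrite !gt_eqF.
  by rewrite ler_pM2r // divr_gt0 ?exprn_gt0 ?mulr_gt0.
have /choice[A hA] : forall g : nat, exists a : int,
    (M + 3 * g)%:Z <= a < (M + 3 * g.+1)%:Z /\
    c' <= dist_int ((conv_step st a).2.2%:~R * x).
  move=> g /=; pose a := (M + 3 * g)%:Z.
  have E (i : nat) : ((a + i) * st.2.2 + st.1.2)%:~R * x =
      (a * st.2.2 + st.1.2)%:~R * x + i%:R * (q * x).
    by rewrite !rmorphD !rmorphM /= rmorphD /= -!pmulrn; ring.
  case: (one_of_three ((a * st.2.2 + st.1.2)%:~R * x) c'4 hq) => h.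
  - by exists a; split => //; rewrite -[a]addr0; exact: (@group_digit _ _ 0%N).
  - exists (a + 1%N); split; first exact: group_digit.
    by rewrite E mul1r.
  - exists (a + 2%N); split; first exact: group_digit.
    by rewrite E.
have Abnd g : (g < 2 * J)%N -> M%:Z <= A g < (2 * M)%:Z.
  by move=> gJ; have [h _] := hA g; rewrite MJ in h *; exact: group_window h.
pose kill Q g := exists2 y, in_node (conv_step st (A g)) y & dist_int (Q%:R * y) < c'.
have [|| e he] := @select_survivors _ (2 * J)%N J s kill; last first.
- exists (fun d => A (e d)); split.
    move=> d dJ; have [eG nk _] := he d dJ; split; first exact: Abnd.
      by case: (hA (e d)).
    move=> y Q hy hQ rQ; rewrite leNgt; apply/negP => lt.
    by apply: (nk Q); [apply/hsQ | exists y].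
  move=> d d' dJ d'J; apply: contra => /eqP AA; apply/eqP.
  have [_ _ inj] := he d dJ; apply: (inj _ d'J).
  have [h1 _] := hA (e d); have [h2 _] := hA (e d').
  by rewrite AA in h1; exact: group_inj h1 h2.
- by rewrite mul2n -addnn leq_add2l.
move=> Q /hsQ[_ /andP[Q1 Q2]] g h gJ hJ [y hy dy] [z hz dz].
apply: contrapT => /eqP gh.
have Agh : A g != A h.
  apply: contra gh => /eqP AA; apply/eqP.
  have [h1 _] := hA g; have [h2 _] := hA h.
  by rewrite AA in h1; exact: group_inj h1 h2.
have sep := child_separation hs (Abnd g gJ) (Abnd h hJ) Agh hy hz.
have inst k w : (k < 2 * J)%N -> in_node (conv_step st (A k)) w -> in_node st w.
  move=> kJ /andP[w1 w2]; have [l1 l2] := child_subset hs (Abnd k kJ).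
  by rewrite (le_trans l1) // (le_trans w2).
have [u hu yu] := in_node_moebius hs m0 (inst g y gJ hy).
have [v hv zv] := in_node_moebius hs m0 (inst h z hJ hz).
have /andP[_ diam] := node_distance hs hu hv.
rewrite -yu -zv -/q in diam; rewrite -/q in sep.
have Q0 : 0 < Q%:R :> R.
  by apply: lt_le_trans Q1; rewrite divr_gt0 ?exprn_gt0 ?mulr_gt0.
have [i hi] := dist_int_lt dy; have [j hj] := dist_int_lt dz.
have QD : `|Q%:R * y - Q%:R * z| = Q%:R * `|y - z|.
  by rewrite -mulrBr normrM gtr0_norm.
have far : Q%:R * `|y - z| < 2^-1.
  apply: (@le_lt_trans _ _ (Q%:R * (m * q ^+ 2)^-1)); first by rewrite ler_pM2l.
  by rewrite ltr_pdivrMr ?mulr_gt0 ?exprn_gt0 // mulrC.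
have ij : i = j.
  apply: (@eq_int_of_close R).
  have -> : (i - j)%:~R = (Q%:R * y - Q%:R * z) - (Q%:R * y - i%:~R)
      + (Q%:R * z - j%:~R) :> R by rewrite rmorphB /=; ring.
  apply: (le_lt_trans (ler_normD _ _)).
  apply: (le_lt_trans (lerD (ler_normB _ _) (lexx _))).
  by rewrite QD; lra.
rewrite -ij in hj.
(* Both y and z are close to the same fraction i / Q. *)
have close : Q%:R * `|y - z| < 2 * c'.
  rewrite -QD.
  have -> : Q%:R * y - Q%:R * z = (Q%:R * y - i%:~R) - (Q%:R * z - i%:~R) by ring.
  by apply: (le_lt_trans (ler_normB _ _)); lra.
move: close; apply/negP; rewrite -leNgt.
apply: (@le_trans _ _ (q ^+ 2 / (18 * m) * (18 * m ^+ 2 * q ^+ 2)^-1)); last first.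
  apply: ler_pM => //.
    by rewrite divr_ge0 ?sqr_ge0 // mulr_ge0 // ltW.
  by rewrite invr_ge0 !mulr_ge0 ?(ltW q0).
have -> : q ^+ 2 / (18 * m) * (18 * m ^+ 2 * q ^+ 2)^-1 = (324 * m ^+ 3)^-1.
  by field; rewrite !gt_eqF.
have p324 : 0 < 324 * m ^+ 3 by rewrite mulr_gt0 ?(ltr0n R 324) ?exprn_gt0.
by rewrite -[leRHS]mul1r ler_pdivlMr //; lra.
Qed.
End Children.

(** * Branches of the tree of ordinates *)

Section Branches.
Local Open Scope classical_set_scope.
Local Open Scope ring_scope.
Variable R : realType.
Notation state := ((int * int) * (int * int))%type.

Section OneBranch.
Variables (M : nat) (y : R) (sg : nat -> state).
Hypothesis M2 : (2 <= M)%N.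
Notation m := (M%:R : R).
Hypothesis sg0 : sg 0%N = ((1, 0), (0, 1)).
Hypothesis sgS : forall k, exists2 a, M%:Z <= a < (2 * M)%:Z & sg k.+1 = conv_step (sg k) a.
Hypothesis sgy : forall k, node_lo m (sg k) <= y <= node_hi m (sg k).

Let m2 : 2 <= m. Proof. by rewrite -[2]/(2%:R) ler_nat. Qed.
Let m0 : 0 < m. Proof. by apply: lt_le_trans m2. Qed.

Lemma branch_regular k : regular_state (sg k).
Proof.
elim: k => [|k IH]; first by rewrite sg0; split => //=; right.
have [a ha ->] := sgS k; apply: regular_step => //.
by have [] := digit_bounds R M2 ha.
Qed.

(** A point of all the nodes of a branch has the digits of the branch as
    partial quotients: successive complete quotients satisfy b = a + 1/b1 with
    b1 >= 2, so that a is the integral part of b.  The branch starts after the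
    partial quotient 0. *)
Lemma branch_cf_state k : cf_state y k.+1 = sg k.
Proof.
have /choice[be hbe] : forall k, exists b, m <= b <= 2 * m /\ y = moebius (sg k) b.
  by move=> j; have [b b1 b2] := in_node_moebius (branch_regular j) m0 (sgy j); exists b.
have be2 j : 2 <= be j by have [/andP[+ _] _] := hbe j; apply: le_trans.
have be0 j : 0 < be j by exact: lt_le_trans (be2 j).
have bi j : 0 < (be j)^-1 <= 2^-1.
  by apply/andP; split; [rewrite invr_gt0 | rewrite lef_pV2 ?posrE].
have beS j : exists2 a, sg j.+1 = conv_step (sg j) a & be j = a%:~R + (be j.+1)^-1.
  have [a ha e] := sgS j; exists a => //.
  have [a1 _ _] := digit_bounds R M2 ha.
  have hj := branch_regular j.
  have a1R : 1 <= a%:~R :> R by rewrite ler1z.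
  apply: (moebius_inj hj) => //.
    by rewrite addr_gt0 //; [exact: lt_le_trans a1R | case/andP: (bi j.+1)].
  rewrite -moebius_step // -e.
  by have [_ <-] := hbe j; have [_ <-] := hbe j.+1.
have fl (a : int) j : Num.floor (a%:~R + (be j)^-1) = a.
  apply: floor_def; rewrite rmorphD /=; have /andP[] := bi j.
  by move=> *; apply/andP; split; lra.
have y0 : y = (be 0%N)^-1.
  have [_ ->] := hbe 0%N; rewrite sg0 /moebius /=.
  by rewrite mulr0 add0r mulr1 addr0 mul1r.
have : cf_state y k.+1 = sg k /\ complete_quotient y k.+1 = be k.
  elim: k => [|k [IH1 IH2]].
    have f0 : partial_quotient y 0 = 0.
      by rewrite /partial_quotient /complete_quotient /= y0 -[_^-1]add0r -[0]/(0%:~R) fl.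
    rewrite cf_stateS f0 sg0; split => //.
    rewrite complete_quotientS f0 subr0 /complete_quotient /= y0 invrK //.
  have [a e1 e2] := beS k.
  have fk : partial_quotient y k.+1 = a.
    by rewrite /partial_quotient IH2 e2 fl.
  rewrite cf_stateS IH1 fk e1; split => //.
  by rewrite complete_quotientS fk IH2 e2 addrAC subrr add0r invrK.
by case.
Qed.

Lemma branch_denom_growth k :
  [/\ 1 <= (sg k).2.2%:~R :> R, m * (sg k).2.2%:~R <= (sg k.+1).2.2%:~R &
      (sg k.+1).2.2%:~R <= 3 * m * (sg k).2.2%:~R].
Proof.
have [q1 /andP[q'0 q'q] _] := branch_regular k.
have [a ha ->] := sgS k; have [a1 a2 a3] := digit_bounds R M2 ha.
rewrite /= rmorphD rmorphM /=.
have q1R : 1 <= (sg k).2.2%:~R :> R by rewrite ler1z.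
have q'R : 0 <= (sg k).1.2%:~R :> R by rewrite ler0z.
have q'qR : (sg k).1.2%:~R <= (sg k).2.2%:~R :> R by rewrite ler_int.
have q0 : 0 <= (sg k).2.2%:~R :> R by exact: le_trans q1R.
split => //.
  by rewrite -[leLHS]addr0 lerD // ler_wpM2r.
have p1 : 0 <= (2 * m - 1 - a%:~R) * (sg k).2.2%:~R.
  by rewrite mulr_ge0 //; lra.
have p2 : 0 <= m * (sg k).2.2%:~R by rewrite mulr_ge0.
lra.
Qed.

Lemma branch_denom_unbounded (B : R) : exists k, B <= (sg k).2.2%:~R.
Proof.
have h k : k%:R <= (sg k).2.2%:~R :> R.
  elim: k => [|k IH]; first by have [+ _ _] := branch_denom_growth 0; apply: le_trans.
  have [q1 + _] := branch_denom_growth k; apply: le_trans.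
  have p : 0 <= (m - 2) * (sg k).2.2%:~R.
    by rewrite mulr_ge0 ?subr_ge0 //; exact: le_trans q1.
  by rewrite -natr1; lra.
exists (Num.bound `|B|); apply: le_trans (h _); apply: le_trans (ler_norm _) _.
by apply: ltW; exact: archi_boundP.
Qed.

Lemma branch_scale (B : R) : exists k, B <= (sg k).2.2%:~R /\
  (k = 0%N \/ (sg k).2.2%:~R < 3 * m * B).
Proof.
have ex : exists k, B <= (sg k).2.2%:~R by exact: branch_denom_unbounded.
have /= := @ex_minnP _ ex; case=> [[|j] hj jmin]; first by exists 0%N; split => //; left.
exists j.+1; split => //; right.
have lt : (sg j).2.2%:~R < B by rewrite ltNge; apply/negP => /jmin; rewrite ltnn.
have [_ _ h] := branch_denom_growth j; apply: (le_lt_trans h).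
by rewrite ltr_pM2l // mulr_gt0.
Qed.

(** Let q be the denominator of a convergent p/q with Q <= q.  If P/Q differs
    from p/q, then 1 <= |P q - Q p| <= Q |q y - p| + q |Q y - P|, where the
    first term is at most 1/2, so that |Q y - P| >= 1/(2q).  If P/Q = p/q, the
    next convergent is used. *)
Lemma branch_bad : badly_approx (36 * m ^+ 2)^-1 y.
Proof.
move=> Q Q0; have QR : 1 <= Q%:R :> R by rewrite -[1]/(1%:R) ler_nat.
have QR0 : 0 < Q%:R :> R by exact: lt_le_trans QR.
apply: (@lt_le_trans _ _ ((18 * m ^+ 2)^-1 * Q%:R^-1)).
  rewrite ltr_pM2r ?invr_gt0 // ltf_pV2 ?posrE ?mulr_gt0 ?exprn_gt0 //.
  by rewrite ltr_pM2r ?exprn_gt0 // ltr_nat.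
apply: dist_int_ge => P.
have [k [Qk qk]] := branch_scale Q%:R.
have {}qk : (sg k).2.2%:~R <= 3 * m * Q%:R.
  case: qk => [->|/ltW //]; rewrite sg0 /=.
  have : 0 <= (m - 2) * Q%:R by rewrite mulr_ge0 ?subr_ge0 // ltW.
  by move: QR; lra.
have claim j : Q%:R <= (sg j).2.2%:~R :> R -> (sg j).2.2%:~R <= 9 * m ^+ 2 * Q%:R ->
    P * (sg j).2.2 - Q%:Z * (sg j).2.1 != 0 ->
    (18 * m ^+ 2)^-1 / Q%:R <= `|Q%:R * y - P%:~R|.
  move=> Qj qj nz; have hj := branch_regular j.
  have [b hb yb] := in_node_moebius hj m0 (sgy j).
  have b0 : 0 < b by case/andP: hb => + _; exact: lt_le_trans.
  have q0 := regular_denom_gt0 R hj.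
  have den := moebius_denom_gt0 hj b0.
  have /andP[den1 _] := moebius_denom_bounds M2 hj hb.
  have D : (sg j).2.2%:~R * y - (sg j).2.1%:~R =
      - (conv_det (sg j))%:~R / (b * (sg j).2.2%:~R + (sg j).1.2%:~R).
    rewrite yb /moebius /conv_det rmorphB !rmorphM /=.
    by field; rewrite gt_eqF.
  set q : R := (sg j).2.2%:~R in Qj qj q0 den den1 D *.
  set de := b * q + _ in den den1 D.
  have nD : `|q * y - (sg j).2.1%:~R| <= (m * q)^-1.
    rewrite D normrM normrN [`|de^-1|]gtr0_norm ?invr_gt0 //.
    have -> : `|(conv_det (sg j))%:~R : R| = 1.
      by case: hj => _ _ [] ->; rewrite ?normrN1 ?normr1.
    by rewrite mul1r lef_pV2 ?posrE // mulr_gt0.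
  have one : 1 <= Q%:R * `|q * y - (sg j).2.1%:~R| + q * `|Q%:R * y - P%:~R|.
    have : 1 <= `|(P * (sg j).2.2 - Q%:Z * (sg j).2.1)%:~R : R|.
      by rewrite norm_intr_ge1 ?intr_eq0 // rpred_int.
    move=> /le_trans; apply.
    have -> : (P * (sg j).2.2 - Q%:Z * (sg j).2.1)%:~R =
       Q%:R * (q * y - (sg j).2.1%:~R) - q * (Q%:R * y - P%:~R) :> R.
      by rewrite rmorphB !rmorphM /= -/q -pmulrn; ring.
    apply: (le_trans (ler_normB _ _)).
    by rewrite !normrM (gtr0_norm QR0) (gtr0_norm q0).
  have half : Q%:R * `|q * y - (sg j).2.1%:~R| <= 2^-1.
    apply: (@le_trans _ _ (q * (m * q)^-1)).
      by apply: ler_pM.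
    have -> : q * (m * q)^-1 = m^-1 by field; rewrite (gt_eqF m0) (gt_eqF q0).
    by rewrite lef_pV2 ?posrE.
  have {}one : 2^-1 <= q * `|Q%:R * y - P%:~R| by lra.
  have : 2^-1 <= 9 * m ^+ 2 * Q%:R * `|Q%:R * y - P%:~R|.
    by apply: (le_trans one); rewrite ler_wpM2r.
  rewrite -ler_pdivrMl ?mulr_gt0 ?exprn_gt0 // => h; apply: le_trans h.
  rewrite le_eqVlt; apply/orP; left; apply/eqP.
  by field; rewrite (gt_eqF m0) (gt_eqF QR0).
have [qk1 kS1 kS] := branch_denom_growth k.
have m1 : 1 <= m by have := m2; lra.
(* P/Q cannot be equal to two successive convergents. *)
have [z|nz] := eqVneq (P * (sg k).2.2 - Q%:Z * (sg k).2.1) 0; last first.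
  apply: (claim k) => //; apply: (le_trans qk).
  have : 0 <= m * (m - 1) * Q%:R by rewrite !mulr_ge0 ?subr_ge0 // ltW.
  have : 0 <= m * m * Q%:R by rewrite !mulr_ge0 // ltW.
  by lra.
apply: (claim k.+1).
- apply: (le_trans Qk); apply: le_trans kS1.
  by rewrite ler_peMl // (le_trans _ qk1).
- apply: (le_trans kS).
  have -> : 9 * m ^+ 2 * Q%:R = 3 * m * (3 * m * Q%:R) by ring.
  by rewrite ler_pM2l // mulr_gt0.
have hk := branch_regular k.
have [a _ ->] := sgS k; rewrite /=.
have -> : P * (a * (sg k).2.2 + (sg k).1.2) - Q%:Z * (a * (sg k).2.1 + (sg k).1.1) =
   a * (P * (sg k).2.2 - Q%:Z * (sg k).2.1) + (P * (sg k).1.2 - Q%:Z * (sg k).1.1) by ring.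
rewrite z mulr0 add0r; apply/negP => /eqP z'.
have : Q%:Z * conv_det (sg k) = 0.
  have -> : Q%:Z * conv_det (sg k) =
    (sg k).2.2 * (P * (sg k).1.2 - Q%:Z * (sg k).1.1) -
    (sg k).1.2 * (P * (sg k).2.2 - Q%:Z * (sg k).2.1) by rewrite /conv_det; ring.
  by rewrite z z' !mulr0 subrr.
by case: hk => _ _ [] -> /eqP; rewrite ?mulrN1 ?mulr1 ?oppr_eq0 eqz_nat eqn0Ngt Q0.
Qed.

(** The ranges of successive generations overlap, since the denominator grows
    by a factor of at most 3M from one to the next: every Q is treated at the
    first generation with Q < M q^2 / 2. *)
Lemma branch_avoids (x c : R) :
  (forall k Q, near_denom x Q ->
    (sg k).2.2%:~R ^+ 2 / (18 * m) <= Q%:R < m * (sg k).2.2%:~R ^+ 2 / 2 ->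
    c <= dist_int (Q%:R * y)) ->
  forall Q, near_denom x Q -> c <= dist_int (Q%:R * y).
Proof.
move=> h Q nQ; have Q0 : (0 < Q)%N by case: nQ.
have QR : 1 <= Q%:R :> R by rewrite -[1]/(1%:R) ler_nat.
pose P k := Q%:R < m * (sg k).2.2%:~R ^+ 2 / 2.
have ex : exists k, P k.
  have [k hk] := branch_denom_unbounded (Q%:R + 1); exists k; rewrite /P.
  set q : R := _%:~R in hk *.
  have : 0 <= (m - 2) * q ^+ 2 by rewrite mulr_ge0 ?subr_ge0 ?sqr_ge0.
  have : 0 <= (q - 1) * q by rewrite mulr_ge0; lra.
  by lra.
have /= := @ex_minnP _ ex; case=> k Pk kmin.
apply: (h k) => //; rewrite -/(P k) Pk andbT.
case: k Pk kmin => [|j] Pk kmin.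
  rewrite ler_pdivrMr ?mulr_gt0 // sg0 /= expr1n.
  have : 0 <= (Q%:R - 1) * m by rewrite mulr_ge0 ?subr_ge0.
  by move: m2; lra.
have nP : m * (sg j).2.2%:~R ^+ 2 / 2 <= Q%:R.
  by rewrite leNgt; apply/negP => /kmin; rewrite ltnn.
have [q1 _ qS] := branch_denom_growth j.
have [q1' _ _] := branch_denom_growth j.+1.
rewrite ler_pdivrMr ?mulr_gt0 //.
apply: (@le_trans _ _ ((3 * m * (sg j).2.2%:~R) ^+ 2)).
  have q'0 : 0 <= (sg j.+1).2.2%:~R :> R by exact: le_trans q1'.
  by rewrite ler_pXn2r // nnegrE //; exact: le_trans qS.
have -> : (3 * m * (sg j).2.2%:~R) ^+ 2 =
  m * (sg j).2.2%:~R ^+ 2 / 2 * (18 * m) by field.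
by rewrite ler_pM2r // mulr_gt0.
Qed.
End OneBranch.
End Branches.

Section Fibre.
Local Open Scope classical_set_scope.
Local Open Scope ring_scope.
Variable R : realType.
Notation state := ((int * int) * (int * int))%type.

(** A tree with J = M / 6 children per node, in which nodes of generation k
    are separated by a multiple of (9 M^2)^-k.  Since b < 1/2, J is at
    least (9 M^2)^b = (18 J)^(2 b) for large J; and J can be so large that it is
    also at least the logarithm of 9 M^2 in base 1 + c/2, as [good_children] needs. *)
Theorem fibre_parametrization (c b : R) : 0 < c -> 0 < b < 2^-1 ->
  exists c1 c2 C : R, [/\ 0 < c1, 0 < c2, 0 < C & forall x, badly_approx c x ->
    exists psi : R -> R, (forall u, [/\ badly_approx c2 (psi u),
        (forall Q, near_denom x Q -> c1 <= dist_int (Q%:R * psi u)) &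
        (forall n, c1 <= dist_int (cf_denom (psi u) n * x))]) /\
      (forall u u', 0 <= u < 1 -> 0 <= u' < 1 ->
         `|u - u'| <= C * `|psi u - psi u'| `^ b)].
Proof.
move=> c0 /andP[b0 b1].
have b2 : 0 < 2 * b < 1 by apply/andP; split; lra.
have [n0 hn0] := @powR_le_linear R (2 * b) 18 b2 ltac:(by []).
have ch0 : 0 < c / 2 by rewrite divr_gt0.
have [J nJ hJ] := @exp_beats_square R (c / 2) 324 (n0 + 2) ch0 (ler0n R 324).
have J2 : (1 < J)%N by apply: leq_trans nJ; rewrite addn2.
have {hn0} powJ : (18 * J%:R) `^ (2 * b) <= J%:R :> R.
  by apply: hn0; apply: leq_trans nJ; exact: leq_addr.
clear n0 nJ; pose M := (6 * J)%N.
have ME : M = (6 * J)%N by [].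
have M2 : (2 <= M)%N by rewrite ME; lia.
have MR : M%:R = 6 * J%:R :> R by rewrite ME natrM.
clearbody M; pose m : R := M%:R.
have m2 : 2 <= m by rewrite -[2]/(2%:R) ler_nat.
have m0 : 0 < m by exact: lt_le_trans m2.
have mE : m = 6 * J%:R by exact: MR.
have mM : M%:R = m by [].
clearbody m.
have hlam : 9 * m ^+ 2 <= (1 + c / 2) ^+ J.
  by apply: le_trans hJ; rewrite mE le_eqVlt; apply/orP; left; apply/eqP; ring.
(* c1 <= c serves the root, whose denominator is 1; the other bound is the
   one under which a denominator of x spoils a single child. *)
pose c1 := Num.min c (648 * m ^+ 3)^-1.
have m3 : 0 < 648 * m ^+ 3 by rewrite mulr_gt0 ?(ltr0n R 648) ?exprn_gt0.
have c10 : 0 < c1 by rewrite lt_min c0 invr_gt0.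
have c1c : c1 <= c by rewrite ge_min lexx.
have c1m : c1 <= (648 * m ^+ 3)^-1 by rewrite ge_min lexx orbT.
have c1m' : 648 * m ^+ 3 * c1 <= 1 by rewrite -ler_pdivlMl // mulr1.
have c14 : c1 <= 4^-1.
  apply: (le_trans c1m); rewrite lef_pV2 ?posrE //.
  have : 1 <= m ^+ 3 by rewrite exprn_ege1 //; lra.
  by lra.
clearbody c1.
pose kappa := (18 * m ^+ 2)^-1; pose rho := (9 * m ^+ 2)^-1.
have k0 : 0 < kappa by rewrite invr_gt0 mulr_gt0 // exprn_gt0.
have r0 : 0 < rho by rewrite invr_gt0 mulr_gt0 // exprn_gt0.
have Nr : 1 <= J%:R * rho `^ b.
  have r1 : 0 < 9 * m ^+ 2 by rewrite mulr_gt0 // exprn_gt0.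
  rewrite -[leLHS](powR_inv_mul b r1) ler_wpM2r ?powR_ge0 //.
  apply: le_trans powJ.
  have -> : 9 * m ^+ 2 = (18 * J%:R) ^+ 2 by rewrite mE; ring.
  by rewrite -powR_mulrn ?mulr_ge0 // -powRrM.
exists c1, (36 * m ^+ 2)^-1, (kappa^-1 `^ b); split => //.
- by rewrite invr_gt0 mulr_gt0 // exprn_gt0.
- by rewrite powR_gt0 // invr_gt0.
move=> x hx.
pose ok (k : nat) (st : state) := [/\ regular_state st,
   c1 <= dist_int (st.2.2%:~R * x) & st.2.2%:~R <= (3 * m) ^+ k].
pose E (k : nat) (st st' : state) :=
  (exists2 a, M%:Z <= a < (2 * M)%:Z & st' = conv_step st a) /\
  (forall y Q, node_lo m st' <= y <= node_hi m st' -> near_denom x Q ->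
     st.2.2%:~R ^+ 2 / (18 * m) <= Q%:R < m * st.2.2%:~R ^+ 2 / 2 ->
         c1 <= dist_int (Q%:R * y)).
have [|||k st [h1 h2 h3]|psi [p1 p2]] := @cantor_tree R state ((1, 0), (0, 1))
  (node_lo m) (node_hi m) ok E J kappa rho b k0 r0 b0 _ Nr => //.
- split => //=; first by split => //; right.
  rewrite mul1r; apply: le_trans c1c _; have := hx 1%N isT.
  by rewrite invr1 mulr1 mul1r => /ltW.
- by move=> k s _; exact: node_lo_hi.
- rewrite -mM in c1m' hlam.
  have [f [f1 f2]] := good_children M2 ME c0 hx c10 c14 c1m' hlam h1 h2.
  rewrite mM in f1.
  have q0 := regular_denom_gt0 R h1.
  exists (fun d => conv_step st (f d)); split.
    move=> d dJ; have [g1 g2 g3] := f1 d dJ.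
    have [a1 a2 a3] := digit_bounds R M2 g1.
    have [s1 s2] := child_subset R M2 h1 g1.
    rewrite mM in s1 s2 a2 a3.
    split => //; last by split => //; exists (f d).
    split => //; first exact: regular_step.
    rewrite exprS /= rmorphD rmorphM /=.
    apply: (@le_trans _ _ (3 * m * st.2.2%:~R)); last by rewrite ler_pM2l // mulr_gt0.
    have q'q : st.1.2%:~R <= st.2.2%:~R :> R by rewrite ler_int; case: h1 => _ /andP[].
    have : 0 <= (2 * m - 1 - (f d)%:~R) * st.2.2%:~R.
      by rewrite mulr_ge0 ?(ltW q0) //; lra.
    have : 0 <= m * st.2.2%:~R by rewrite mulr_ge0 ?ltW.
    by lra.
  move=> d e dJ eJ de y z hy hz.
  have [g1 _ _] := f1 d dJ; have [g2 _ _] := f1 e eJ.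
  rewrite -mM in hy hz.
  have := child_separation M2 h1 g1 g2 (f2 d e dJ eJ de) hy hz.
  rewrite mM; apply: le_trans.
  rewrite /kappa /rho exprVn -invfM lef_pV2 ?posrE ?mulr_gt0 ?exprn_gt0 ?mulr_gt0 ?exprn_gt0 //.
  rewrite ler_pM2l ?mulr_gt0 ?exprn_gt0 //.
  have -> : 9 * m ^+ 2 = (3 * m) ^+ 2 by ring.
  rewrite -exprM mulnC exprM ler_pXn2r ?nnegrE ?exprn_ge0 ?mulr_ge0 ?(ltW q0) ?(ltW m0) //.
exists psi; split => // u; have [sg [sg0 hsg]] := p1 u.
have sgS k : exists2 a, M%:Z <= a < (2 * M)%:Z & sg k.+1 = conv_step (sg k) a.
  by have [_ [+ _] _] := hsg k.
have sgy k : node_lo M%:R (sg k) <= psi u <= node_hi M%:R (sg k).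
  by rewrite mM; have [_ _] := hsg k.
have bad : badly_approx (36 * m ^+ 2)^-1 (psi u).
  by rewrite -mM; exact: (branch_bad M2 sg0 sgS sgy).
split => //.
  apply: (branch_avoids M2 sg0 sgS) => k Q nQ rQ; rewrite mM in rQ.
  have [_ [_ h] _] := hsg k; apply: h nQ rQ.
  by have [_ _] := hsg k.+1.
move=> n; have Bpsi : Bad (psi u).
  exists (36 * m ^+ 2)^-1 => //.
  by rewrite invr_gt0 mulr_gt0 // exprn_gt0.
have [q [_ -> e _]] := bad_cf_denom n Bpsi.
rewrite (branch_cf_state M2 sg0 sgS sgy) in e.
have [[_ h _] _ _] := hsg n.
by rewrite e -pmulrn in h.
Qed.
End Fibre.

(** * Hausdorff dimension in the plane is at most two *)

Section Plane.
Local Open Scope classical_set_scope.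
Local Open Scope ring_scope.
Variable R : realType.

Lemma sum_by_powers_of_4 (b : nat -> R) (g : nat -> R) m :
  (forall n i, (4 ^ n <= i < 4 ^ n.+1)%N -> b i <= g n) ->
  b 0%N <= 0 ->
  \sum_(0 <= i < 4 ^ m) b i <= \sum_(0 <= n < m) 3 * 4 ^+ n * g n.
Proof.
move=> hb b0; elim: m => [|m IH]; first by rewrite expn0 big_nat1 big_nil.
have h4 : (4 ^ m <= 4 ^ m.+1)%N by rewrite leq_exp2l.
rewrite (@big_cat_nat _ _ _ (4 ^ m)) //= big_nat_recr //=.
apply: lerD => //.
apply: (@le_trans _ _ (\sum_(4 ^ m <= i < 4 ^ m.+1) g m)).
  by apply: ler_sum_nat => i hi; exact: hb.
rewrite big_const_nat iter_addr_0 expnS -[X in (_ - X)%N]mul1n -mulnBl.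
by rewrite -[leLHS]mulr_natl natrM natrX.
Qed.

Lemma euclidean_dist_cell (u v : R * R) (h : R) : 0 <= h ->
  `|u.1 - v.1| <= h -> `|u.2 - v.2| <= h -> euclidean_dist u v <= 2 * h.
Proof.
move=> h0 h1 h2; rewrite /euclidean_dist.
have h4 : 0 <= 2 * h by rewrite mulr_ge0.
have e : Num.sqrt ((2 * h) ^+ 2) = 2 * h by rewrite sqrtr_sqr ger0_norm.
rewrite -[leRHS]e; apply: ler_wsqrtr.
have s1 : (u.1 - v.1) ^+ 2 <= h ^+ 2.
  by rewrite -real_normK ?num_real // ler_pXn2r // nnegrE.
have s2 : (u.2 - v.2) ^+ 2 <= h ^+ 2.
  by rewrite -real_normK ?num_real // ler_pXn2r // nnegrE.
have : 0 <= h ^+ 2 by exact: sqr_ge0.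
by lra.
Qed.

Lemma euclidean_dist_ge0 (u v : R * R) : 0 <= euclidean_dist u v.
Proof. exact: sqrtr_ge0. Qed.

Definition grid_cell (w h : R) (i j : nat) : set (R * R) :=
  [set z | 0 <= z.1 + w - i%:R * h <= h /\ 0 <= z.2 + w - j%:R * h <= h].

Lemma diameter_grid_cell (w h : R) i j : 0 <= h ->
  (diameter (@euclidean_dist R) (grid_cell w h i j) <= (2 * h)%:E)%E.
Proof.
move=> h0; rewrite /diameter ge_max lee_fin mulr_ge0 //=.
apply: ge_ereal_sup => _ [u [/andP[u1 u2] /andP[u3 u4]] [v [/andP[v1 v2] /andP[v3 v4]] <-]].
rewrite lee_fin; apply: euclidean_dist_cell => //.
  by rewrite ler_norml; apply/andP; split; lra.
by rewrite ler_norml; apply/andP; split; lra.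
Qed.

Lemma hausdorff_gauge_le (U : set (R * R)) (s d : R) : 0 <= s ->
  (diameter (@euclidean_dist R) U <= d%:E)%E ->
  (hausdorff_gauge (@euclidean_dist R) s U <= (d `^ s)%:E)%E.
Proof.
move=> s0 hd; rewrite /hausdorff_gauge; case: pselect => h.
  by rewrite lee_fin powR_ge0.
have [e -> /andP[e0 ed]] := diameter_fin hd.
by rewrite poweR_EFin lee_fin; exact: ler_powR_base.
Qed.

Lemma hausdorff_gauge_ge0 (U : set (R * R)) (s : R) :
  (0 <= hausdorff_gauge (@euclidean_dist R) s U)%E.
Proof.
by rewrite /hausdorff_gauge; case: pselect => h; [exact: lexx | exact: poweR_ge0].
Qed.

Lemma hausdorff_gauge0 (s : R) : hausdorff_gauge (@euclidean_dist R) s set0 = 0%E.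
Proof. by rewrite /hausdorff_gauge; case: pselect. Qed.

Lemma diameter0 : diameter (@euclidean_dist R) set0 = 0%E.
Proof.
rewrite /diameter max_l //; apply: ge_ereal_sup => _ [u []].
Qed.

Lemma nneseries_le_pow4 (a : nat -> \bar R) (M : R) : (forall i, 0 <= a i)%E ->
  (forall m, \sum_(0 <= i < 4 ^ m) a i <= M%:E)%E -> (\sum_(i <oo) a i <= M%:E)%E.
Proof.
move=> a0 h; apply: lime_le; first by apply: is_cvg_nneseries => *; exact: a0.
apply: nearW => m; apply: le_trans (h m).
by apply: lee_sum_nneg_natr => //; exact/ltnW/ltn_expl.
Qed.

(** Since 2 v > 1, the squares [-(2v)^n, (2v)^n]^2 exhaust the plane. *)
Lemma grid_covers (v : R) (N : nat) (z : R * R) : 2^-1 < v ->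
  exists n i j, [/\ (N <= n)%N, (i < 2 ^ n)%N, (j < 2 ^ n)%N &
    grid_cell ((2 * v) ^+ n) (2 * v ^+ n) i j z].
Proof.
move=> v1; have v0 : 0 < v by apply: lt_trans v1; rewrite invr_gt0.
pose c := `|z.1| + `|z.2| + 1.
have h0 : 0 < 2 * v - 1 by rewrite subr_gt0 -ltr_pdivrMl // mulr1.
have c0 : 0 <= c / (2 * v - 1) by rewrite divr_ge0 ?(ltW h0) // /c !addr_ge0.
pose n := (N + Num.bound (c / (2 * v - 1)))%N.
have cw : c <= (2 * v) ^+ n.
  have := bernoulli_ineq n (ltW h0); rewrite subrKC; apply: le_trans.
  have : c / (2 * v - 1) <= n%:R.
    by apply: le_trans (ltW (archi_boundP c0)) _; rewrite ler_nat leq_addl.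
  by rewrite ler_pdivrMr // => /le_trans; apply; rewrite lerDr.
set w := (2 * v) ^+ n in cw *; set h := 2 * v ^+ n.
have hh0 : 0 < h by rewrite mulr_gt0 // exprn_gt0.
have wh : 2 * w = (2 ^ n)%:R * h by rewrite natrX /w /h exprMn; ring.
have idx (x : R) : `|x| < w -> exists2 i : nat, (i < 2 ^ n)%N & 0 <= x + w - i%:R * h <= h.
  rewrite ltr_norml => /andP[x1 x2].
  have p0 : 0 <= (x + w) / h by rewrite divr_ge0 //; [lra | exact: ltW].
  have /andP[t1 t2] := truncn_itv p0.
  exists (Num.trunc ((x + w) / h)).
    rewrite truncn_lt_nat // ltr_pdivrMr // -wh; lra.
  move: t1 t2; rewrite -natr1 ler_pdivlMr // ltr_pdivrMr // => t1 t2.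
  by apply/andP; split; lra.
have z1 : `|z.1| < w.
  by apply: lt_le_trans cw; rewrite /c; have := normr_ge0 z.2; lra.
have z2 : `|z.2| < w.
  by apply: lt_le_trans cw; rewrite /c; have := normr_ge0 z.1; lra.
have [i i1 i2] := idx _ z1; have [j j1 j2] := idx _ z2.
by exists n, i, j; split => //; rewrite /n leq_addr.
Qed.

(** The sets of the cover are numbered so that those with
    4^n <= i < 4^(n + 1) are cells of the n-th grid, and only grids with n >= N
    are used.  The n-th grid contributes a multiple of (4 v^s)^n, and v is chosen
    with 1/2 < v and 4 v^s < 1, which is possible because s > 2. *)
Lemma hausdorff_premeasure_plane (s delta e : R) (E : set (R * R)) : 2 < s ->
  0 < delta -> 0 < e ->
  (hausdorff_premeasure (@euclidean_dist R) s delta E <= e%:E)%E.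
Proof.
move=> s2 d0 e0; have s0 : 0 < s by lra.
(* r is the midpoint of 2/s and 1, and v = 2^-r. *)
pose r := (1 + 2 / s) / 2; pose v : R := expR (- (r * ln 2)).
have ts1 : 2 / s < 1 by rewrite ltr_pdivrMr // mul1r.
have ts0 : 0 < 2 / s by rewrite divr_gt0.
have avg (q : R) : q < 1 -> (1 + q) / 2 < 1 by move=> ?; lra.
have r1 : r < 1 by exact: avg.
have avg0 (q : R) : 0 < q -> 0 < (1 + q) / 2 by move=> ?; lra.
have r0 : 0 < r by exact: avg0.
have rs : 2 < r * s.
  have -> : r * s = (s + 2) / 2 by rewrite /r; field; rewrite gt_eqF.
  by lra.
have l2 : 0 < ln 2 :> R by rewrite ln_gt0 // -[1]/(1%:R) ltr_nat.
have e2 : expR (- ln 2) = 2^-1 :> R by rewrite expRN lnK ?posrE.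
have v0 : 0 < v by exact: expR_gt0.
have v1 : 2^-1 < v.
  by rewrite -e2 ltr_expR ltrN2 -[ltRHS]mul1r ltr_pM2r.
have v2 : v < 1 by rewrite -[ltRHS]expR0 ltr_expR oppr_lt0 mulr_gt0.
pose xi := 4 * v `^ s.
have x0 : 0 < xi by rewrite mulr_gt0 // powR_gt0.
have x1 : xi < 1.
  rewrite /xi /v -expRM.
  have : expR (- (r * ln 2) * s) < expR (- ln 2 + - ln 2).
    rewrite ltr_expR -opprD mulNr ltrN2.
    have : 0 < (r * s - 2) * ln 2 by rewrite mulr_gt0 // subr_gt0.
    lra.
  by rewrite expRD e2; lra.
pose K := 3 * 4 `^ s.
have K0 : 0 < K by rewrite mulr_gt0 // powR_gt0.
have [N1 hN1] := geometric_small (introT andP (conj v0 v2)) (divr_gt0 d0 (ltr0n R 4)).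
have x1' : 0 < 1 - xi by rewrite subr_gt0.
have e1 : 0 < e * (1 - xi) / K by rewrite divr_gt0 // mulr_gt0.
have [N2 hN2] := geometric_small (introT andP (conj x0 x1)) e1.
pose N := (N1 + N2).+1.
have NN1 : (N1 <= N)%N by exact: leqW (leq_addr _ _).
have NN2 : (N2 <= N)%N by exact: leqW (leq_addl _ _).
have N0 : (0 < N)%N by [].
clearbody N.
pose lev := trunc_log 4.
pose U (i : nat) : set (R * R) :=
  if (N <= lev i)%N then grid_cell ((2 * v) ^+ lev i) (2 * v ^+ lev i)
    ((i - 4 ^ lev i) %/ 2 ^ lev i) ((i - 4 ^ lev i) %% 2 ^ lev i) else set0.
have dU i : (N <= lev i)%N ->
    (diameter (@euclidean_dist R) (U i) <= (4 * v ^+ lev i)%:E)%E.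
  move=> h; rewrite /U h; have -> : 4 * v ^+ lev i = 2 * (2 * v ^+ lev i) by ring.
  by apply: diameter_grid_cell; rewrite mulr_ge0 // exprn_ge0 // ltW.
pose b i : R := if (N <= lev i)%N then 4 `^ s * (v `^ s) ^+ lev i else 0.
have bU i : (hausdorff_gauge (@euclidean_dist R) s (U i) <= (b i)%:E)%E.
  rewrite /b; case: ifP => h; last by rewrite /U h hausdorff_gauge0.
  apply: (le_trans (hausdorff_gauge_le (ltW s0) (dU i h))).
  by rewrite powRM ?exprn_ge0 ?(ltW v0) // powRX // ltW.
have cover : delta_cover (@euclidean_dist R) delta E U.
  split.
    move=> z _; have [n [i [j [Nn i2 j2 hz]]]] := grid_covers N z v1.
    have p2 : (0 < 2 ^ n)%N by rewrite expn_gt0.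
    have ij : (i * 2 ^ n + j < 4 ^ n)%N.
      have -> : (4 ^ n = 2 ^ n * 2 ^ n)%N by rewrite -expnMn.
      apply: (@leq_trans (i * 2 ^ n + 2 ^ n)); first by rewrite ltn_add2l.
      by rewrite -mulSnr leq_mul2r i2 orbT.
    exists (4 ^ n + (i * 2 ^ n + j))%N => //.
    have ln : lev (4 ^ n + (i * 2 ^ n + j))%N = n.
      apply: trunc_log_eq => //; rewrite leq_addr /= expnS.
      by apply: (@leq_trans (4 ^ n + 4 ^ n)); rewrite ?ltn_add2l // addnn -mul2n leq_mul2r orbT.
    rewrite /U ln Nn addKn divnMDl // divn_small // addn0 modnMDl modn_small //.
  move=> i; have [h|h] := boolP (N <= lev i)%N; last first.
    by rewrite /U (negbTE h) diameter0 lee_fin ltW.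
  apply: (le_trans (dU i h)); rewrite lee_fin mulrC -ler_pdivlMr //.
  by apply: hN1; exact: leq_trans h.
apply: ge_ereal_inf.
exists (\sum_(i <oo) hausdorff_gauge (@euclidean_dist R) s (U i))%E; first by exists U.
apply: nneseries_le_pow4 => [i|m]; first exact: hausdorff_gauge_ge0.
apply: (@le_trans _ _ (\sum_(0 <= i < 4 ^ m) (b i)%:E)%E).
  by apply: lee_sum => i _; exact: bU.
rewrite sumEFin lee_fin.
pose g n := if (N <= n)%N then 4 `^ s * (v `^ s) ^+ n else 0.
apply: (@le_trans _ _ (\sum_(0 <= n < m) 3 * 4 ^+ n * g n)).
  apply: sum_by_powers_of_4; last by rewrite /b /lev trunc_log0 leqNgt N0.
  by move=> n i hi; rewrite /b /lev (trunc_log_eq _ hi).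
have gs : \sum_(0 <= n < m) 3 * 4 ^+ n * g n <= K * (xi ^+ N - xi ^+ maxn N m) / (1 - xi).
  elim: m => [|m IH]; first by rewrite big_nil maxn0 subrr mulr0 mul0r.
  rewrite big_nat_recr //= /g; case: leqP => h.
    rewrite (maxn_idPr h) in IH; rewrite (maxn_idPr (leqW h)).
    have -> : K * (xi ^+ N - xi ^+ m.+1) / (1 - xi) =
       K * (xi ^+ N - xi ^+ m) / (1 - xi) + K * xi ^+ m.
      by rewrite exprS; field; rewrite gt_eqF.
    apply: lerD => //; rewrite /K /xi exprMn le_eqVlt; apply/orP; left; apply/eqP; ring.
  rewrite mulr0 addr0; move: IH; rewrite (maxn_idPl (ltnW h)).
  by rewrite (maxn_idPl h).
apply: (le_trans gs).
rewrite ler_pdivrMr // -ler_pdivlMl // [K^-1 * _]mulrC.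
apply: (@le_trans _ _ (xi ^+ N)); first by rewrite gerBl exprn_ge0 // ltW.
exact: hN2.
Qed.

Lemma hausdorff_dim_plane (E : set (R * R)) :
  (hausdorff_dim (@euclidean_dist R) E <= 2%:E)%E.
Proof.
apply/lee_addgt0Pr => e e0; rewrite -EFinD.
apply: ereal_inf_lbound; exists (2 + e) => //; split; first by lra.
apply/eqP; rewrite eq_le; apply/andP; split.
  apply: ge_ereal_sup => _ [delta d0 <-].
  apply/lee_addgt0Pr => e' e'0; rewrite add0e.
  by apply: hausdorff_premeasure_plane => //; lra.
apply: (@le_trans _ _ (hausdorff_premeasure (@euclidean_dist R) (2 + e) 1 E)).
  apply: le_ereal_inf_tmp => _ [U _ <-]; apply: nneseries_ge0 => i _ _.
  exact: hausdorff_gauge_ge0.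
by apply: ereal_sup_ubound; exists 1 => //=.
Qed.
End Plane.

(** * The two bounds *)

Section Conclusion.
Local Open Scope classical_set_scope.
Local Open Scope ring_scope.
Variable R : realType.

(** A product is bounded below by the two factors q ||q x||, from bad
    approximability, and ||q y||. *)
Lemma littlewood_set_mem (c c1 c2 x y : R) : 0 < c -> 0 < c1 -> 0 < c2 ->
  badly_approx c x -> badly_approx c2 y ->
  (forall Q, near_denom x Q -> c1 <= dist_int (Q%:R * y)) ->
  (forall n, c1 <= dist_int (cf_denom y n * x)) -> cf_littlewood_set (x, y).
Proof.
move=> c0 c10 c20 hx hy hQ hn.
have Bx : Bad x by exists c.
have By : Bad y by exists c2.
have low (e z w : R) (q : nat) : 0 < e -> badly_approx e z -> (0 < q)%N ->
    c1 <= w -> e * c1 <= q%:R * dist_int (q%:R * z) * w.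
  move=> e0 hz q0 cw; have qR : 0 < q%:R :> R by rewrite ltr0n.
  apply: ler_pM => //; [exact: ltW | exact: ltW |].
  by rewrite mulrC -ler_pdivrMr //; apply/ltW/hz.
split => //; exists (Num.min (c * c1) (c2 * c1)).
  by rewrite lt_min !mulr_gt0.
move=> n _ /=; split.
- have [q [q0 -> _ np]] := bad_cf_denom n Bx.
  rewrite ge_min; apply/orP; left; apply: low => //.
  by apply: hQ; split.
- have := hn n; have [q [q0 -> _ _]] := bad_cf_denom n By => cn.
  rewrite ge_min; apply/orP; right; rewrite mulrAC.
  exact: low.
Qed.

Lemma dist_fst_le (p q : R * R) : `|p.1 - q.1| <= euclidean_dist p q.
Proof. by rewrite /euclidean_dist -sqrtr_sqr ler_wsqrtr // lerDl sqr_ge0. Qed.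

Lemma dist_snd_le (p q : R * R) : `|p.2 - q.2| <= euclidean_dist p q.
Proof. by rewrite /euclidean_dist -sqrtr_sqr ler_wsqrtr // lerDr sqr_ge0. Qed.

Lemma littlewood_measure_neq0 (a b s : R) : 0 < a < 1 -> 0 < b < 2^-1 -> s <= a + b ->
  hausdorff_measure (@euclidean_dist R) s (@cf_littlewood_set R) <> 0%E.
Proof.
move=> ha hb hs; have /andP[a0 _] := ha; have /andP[b0 _] := hb.
have [c [C [phi [c0 C0 hphi hol]]]] := bad_parametrization ha.
have [c1 [c2 [C' [c10 c20 C'0 fib]]]] := fibre_parametrization c0 hb.
have /choice[psi hpsi] := fun t => fib (phi t) (hphi t).
apply: (@hausdorff_measure_param_neq0 R (R * R)%type _ (@euclidean_dist_ge0 R) _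
  (fun t u => (phi t, psi t u)) a b (C + C')) => //.
- exact: addr_gt0.
- move=> t u _ _; have [/(_ u)[h1 h2 h3] _] := hpsi t.
  exact: (littlewood_set_mem c0 c10 c20 (hphi t)).
- move=> t t' u u' ht ht' hu hu'; apply: (le_trans (hol _ _ ht ht')).
  apply: ler_pM; rewrite ?powR_ge0 ?(ltW C0) ?lerDl ?(ltW C'0) //.
  by apply: ler_powR_base; [exact: ltW | exact: normr_ge0 | exact: (dist_fst_le (_, _) (_, _))].
- move=> t u u' ht hu hu'; have [_ h] := hpsi t.
  apply: (le_trans (h _ _ hu hu')).
  apply: ler_pM; rewrite ?powR_ge0 ?(ltW C'0) ?lerDr ?(ltW C0) //.
  by apply: ler_powR_base; [exact: ltW | exact: normr_ge0 | exact: (dist_snd_le (_, _) (_, _))].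
Qed.

End Conclusion.

Local Open Scope ring_scope.
Local Open Scope ereal_scope.

Theorem proposition1 (R : realType) :
  (3 / 2 : R)%:E <= hausdorff_dim (@euclidean_dist R) (@cf_littlewood_set R) /\
  hausdorff_dim (@euclidean_dist R) (@cf_littlewood_set R) <= (2 : R)%:E.
Proof.
split; last exact: hausdorff_dim_plane.
apply/ereal_infP => _ [s [s0 hs] <-]; rewrite lee_fin leNgt; apply/negP => s32.
(* s is raised to s' >= 1 in order to keep 1/2 - e positive. *)
pose s' := Num.max s 1%R; pose e := ((3 / 2 - s') / 2)%R.
have s'1 : (1 <= s')%R by rewrite le_max lexx orbT.
have ss' : (s <= s')%R by rewrite le_max lexx.
have s'2 : (s' < 3 / 2)%R by rewrite gt_max s32; lra.
apply: (@littlewood_measure_neq0 R (1 - e) (2^-1 - e) s) hs.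
- by apply/andP; split; rewrite /e; lra.
- by apply/andP; split; rewrite /e; lra.
- by rewrite /e; lra.
Qed.
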